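(* Let $R,K,N,s$ be positive integers with $s\le N$, $m=RK$, $p\in[0,1]$, $\epsilon>0$, $c>0$. There is a constant $C>0$ depending only on $c$ such that the following holds. Let $\mathbf{A}\in\mathbb{R}^{m\times N}$ be a subGaussian random matrix with parameter $c$, and let $\mathcal{T}\subseteq\{1,\ldots,m\}$ be the random set of indices of measurements observed at the fusion center of a serial-star network with $R$ branches of $K$ sensors (independent of $\mathbf{A}$). Let $\delta\in(0,1)$. If $$R\ \ge\ \left[\ln\frac{1-pe^{-C\delta^2}}{1-p+p\left(1-e^{-C\delta^2}\right)\left(pe^{-C\delta^2}\right)^K}\right]^{-1}\left[\frac{4}{3}s\ln\left(\frac{eN}{s}\right)+\frac{14}{3}s+\frac{4}{3}\ln\frac{2}{\epsilon}\right],$$ then with probability at least $1-\epsilon$ the $s$-restricted isometry constant $\delta_s$ of $|\mathcal{T}|^{-1/2}\mathbf{A}_{\mathcal{T}}$ satisfies $\delta_s<\delta$.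
   Context: A random variable $A$ is subGaussian with parameter $c$ if $\mathbb{E}[\exp(\theta A)]\le\exp(c\theta^2)$ for all $\theta\in\mathbb{R}$; a subGaussian random matrix with parameter $c$ has independent, zero mean, unit variance subGaussian entries with common parameter $c$. Serial-star network: the $m=RK$ sensors are arranged in $R$ branches; in each branch sensor $j$ ($j=1,\ldots,K$) forwards all measurements it holds (its own plus those received from sensor $j-1$) to sensor $j+1$, and sensor $K$ forwards to the fusion center. Each of the $RK$ links (sensor $j\to j+1$ for $j<K$, and sensor $K\to$ fusion center) is an independent Bernoulli erasure channel delivering the transmitted data with probability $p$ and losing it otherwise; thus the measurement of sensor $j$ in a branch reaches the fusion center iff all $K-j+1$ links from sensor $j$ onward succeed. $\mathcal{T}$ is the set of indices of measurements reaching the fusion center and $\mathbf{A}_{\mathcal{T}}$ the submatrix of rows indexed by $\mathcal{T}$. The $s$-restricted isometry constant of a matrix $\mathbf{B}$ with $N$ columns is $\delta_s=\inf\{\delta:1-\delta\le\|\mathbf{B}\mathbf{z}\|^2\le1+\delta\ \forall\mathbf{z},\ \|\mathbf{z}\|=1,\ \|\mathbf{z}\|_0\le s\}$. The right-hand side is $+\infty$ when $p=0$. *)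

(* Defs.v *)
From HB Require Import structures.
From mathcomp Require Import all_boot all_order all_algebra.
From mathcomp Require Import all_classical all_reals all_analysis.
Set Implicit Arguments. Unset Strict Implicit. Unset Printing Implicit Defensive.
Import Order.TTheory GRing.Theory Num.Theory.
Local Open Scope ring_scope.
Local Open Scope classical_set_scope.

Section Defs.
Variable R : realType.

Definition sqnorm (k : nat) (v : 'cV[R]_k) : R := \sum_(i < k) (v i 0) ^+ 2.

Definition l0norm (k : nat) (v : 'cV[R]_k) : nat := #|[set i : 'I_k | v i 0 != 0]|.

Definition ric (k N : nat) (B : 'M[R]_(k, N)) (s : nat) : R :=
  inf [set d : R | forall z : 'cV[R]_N, sqnorm z = 1 -> (l0norm z <= s)%N ->
         1 - d <= sqnorm (B *m z) <= 1 + d].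

Definition subrows (m N : nat) (T : {set 'I_m}) (A : 'M[R]_(m, N)) : 'M[R]_(#|T|, N) :=
  \matrix_(i < #|T|, j < N) A (enum_val i) j.

Definition normalized_sub (m N : nat) (T : {set 'I_m}) (A : 'M[R]_(m, N)) : 'M[R]_(#|T|, N) :=
  (Num.sqrt (#|T|%:R))^-1 *: subrows T A.

Definition mutually_independent (d : measure_display) (Omega : measurableType d)
  (P : probability Omega R) (I : finType) (X : I -> {RV P >-> R}) : Prop :=
  forall (J : {set I}) (B : I -> set R), (forall i, measurable (B i)) ->
    P (\bigcap_(i in [set i | i \in J]) (X i @^-1` B i)) =
    (\prod_(i in J) P (X i @^-1` B i))%E.

Definition subGaussian (d : measure_display) (Omega : measurableType d)
  (P : probability Omega R) (X : {RV P >-> R}) (c : R) : Prop :=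
  forall theta : R, (\int[P]_w (expR (theta * X w))%:E <= (expR (c * theta ^+ 2))%:E)%E.

(* Serial-star network with nb branches of K sensors, m = nb * K measurements.
   Measurement index i : 'I_(nb*K) is sensor (i %% K) (0-based) of branch (i %/ K).
   The link variable L i' (values 0/1, 1 = success) is the outgoing link of
   sensor (i' %% K) of branch (i' %/ K): to the next sensor, or to the fusion
   center when i' %% K = K-1.  Measurement i reaches the fusion center iff all
   links from its sensor onward in its branch succeed. *)
Definition received_set (nb K : nat) (Omega : Type) (L : 'I_(nb * K) -> Omega -> R)
  (w : Omega) : {set 'I_(nb * K)} :=
  [set i : 'I_(nb * K) | [forall i' : 'I_(nb * K),
      ((i' %/ K == i %/ K)%N && (i <= i')%N) ==> (L i' w == 1)]].

(* the sufficient number of branches (valid for 0 < p; it is +oo for p = 0) *)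
Definition branch_bound (C delta p eps : R) (K N s : nat) : R :=
  let x := C * delta ^+ 2 in
  let q := p * expR (- x) in
  (ln ((1 - q) / (1 - p + p * (1 - expR (- x)) * q ^+ K)))^-1 *
  (4 / 3 * s%:R * ln (expR 1 * N%:R / s%:R) + 14 / 3 * s%:R + 4 / 3 * ln (2 / eps)).

End Defs.

(* Main.v *)
(** The event that the restricted isometry constant is at least [delta] is
    contained in a finite union of events, one per point of a grid of sparse
    vectors: rounding a sparse unit vector towards the grid and polarising shows
    that a defect [| |Bv|^2 - |v|^2 |] at most [delta / 4] on the grid forces a
    defect at most [delta / 2] on all sparse unit vectors, and the grid has at
    most [(32 e N / s)^s] points.  For a fixed set [T] of received measurements
    and a fixed vector, the defect is an average of [|T|] independent centred
    squares of subGaussian variables, so Chernoff's bound gives the tail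
    [2 exp (- C delta^2 |T|)].  Averaging over [T], which is independent of the
    matrix, produces the generating function [E y^|T|] at [y = exp (- C delta^2)];
    it factorises over the branches into the [nb]-th power of
    [(1 - p + p (1 - y) (p y)^K) / (1 - p y)], the inverse of the quantity inside
    the logarithm of the bound. *)

Require Import Defs.
From HB Require Import structures.
From mathcomp Require Import all_boot all_order all_algebra.
From mathcomp Require Import all_classical all_reals all_analysis.
From mathcomp Require Import measurable_realfun.
From mathcomp Require Import ring lra zify.
Set Implicit Arguments.
Unset Strict Implicit.
Unset Printing Implicit Defensive.
Import Order.TTheory GRing.Theory Num.Theory.
Local Open Scope ring_scope.
Local Open Scope classical_set_scope.

(** Independence is assumed only for events fixing each variable separately, whereas the proof needs
    it between functions of whole rows, and between the link pattern and the matrix. Hence the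
    sigma-algebras generated by blocks of variables, where independence becomes disjointness of
    index sets.

    Polarisation is what allows a coarse grid. The difference of two values of the defect becomes a
    difference of values at [u + v] and [u - v], with [u = a (x - y)] and [v = (x + y) / 2] both in
    the unit ball, at the price of a factor [1 / (2 a)]. With [a = 4] the defect at most doubles
    from grid to ball. Rounding at scale [1 / (a sqrt s)] also bounds the sum of the integer
    coordinates by [a s], so the number of grid points is exponential in [s] only, up to the choice
    of support.

    The law of [|T|] is never computed: within a branch the received sensors form a final segment,
    so [y ^ count] is affine in the survival indicators and only their means [p ^ (K - j)] enter.

    The infimum defining the isometry constant quantifies over uncountably many vectors, so the
    measurability of the final event needs its own argument, again by grids. *)

(** * Independence of sigma-algebras generated by disjoint blocks of variables *)

Section Blocks.
Context {R : realType} {d : measure_display} {Omega : measurableType d}.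
Variable P : probability Omega R.
Local Open Scope ereal_scope.

(** For fixed [F], the measurable sets [E] satisfying the product rule form a Dynkin system, so it
    suffices to check the rule on a generating pi-system. *)
Lemma pi_system_indep (G : set (set Omega)) (F : set Omega) :
    setI_closed G -> G `<=` measurable -> measurable F ->
    (forall E, G E -> P (E `&` F) = P E * P F) ->
  forall E, <<s G >> E -> measurable E /\ P (E `&` F) = P E * P F.
Proof.
move=> GI Gm mF GF.
suff : <<s G >> `<=` [set E | measurable E /\ P (E `&` F) = P E * P F].
  by move=> H E /H.
have Ffin : P F \is a fin_num by exact: fin_num_measure.
apply: lambda_system_subset => //; last by move=> E GE; split; [exact: Gm|exact: GF].
apply/dynkin_lambda_system; split.
- by split => //; rewrite setTI probability_setT mul1e.
- move=> E [mE EF]; split; first exact: measurableC.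
  rewrite probability_setC// muleBl ?fin_num_adde_defr ?mul1e//; last first.
  rewrite -EF setIC -setDE measureD//; last first.
    by rewrite (le_lt_trans (probability_le1 P mF))// ltry.
  by rewrite setIC.
- move=> A tA H; have mA n := (H n).1; split; first exact: bigcup_measurable.
  rewrite setI_bigcupl.
  rewrite measure_bigcup//; first last.
  + by apply: trivIset_setIr.
  + by move=> n _; apply: measurableI.
  rewrite (eq_eseriesr (fun n _ => (H n).2)).
  rewrite [in RHS]measure_bigcup// muleC -(fineK Ffin) -nneseriesZl//.
  by apply: eq_eseriesr => n _; rewrite muleC.
Qed.

Variables (I : finType) (X : I -> {RV P >-> R}).

Definition cylinders (J : {set I}) : set (set Omega) :=
  [set E | exists2 B : I -> set R, (forall i, measurable (B i)) &
     E = \bigcap_(i in [set i | i \in J]) (X i @^-1` B i)].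

(** A copy of [Omega] with a smaller sigma-algebra: that a function depends only on the variables in
    [J] is expressed as its measurability on [block J]. *)
Definition block (J : {set I}) : measurableType _ :=
  g_sigma_algebraType (cylinders J).

Lemma cylinder_measurable J : cylinders J `<=` measurable.
Proof.
move=> E [B mB ->]; apply: fin_bigcap_measurable => //.
by move=> i _; rewrite -[_ @^-1` _]setTI; exact: measurable_funPT.
Qed.

Lemma cylinders_setI J : setI_closed (cylinders J).
Proof.
move=> E F [B mB ->] [B' mB' ->].
exists (fun i => B i `&` B' i); first by move=> i; apply: measurableI.
by rewrite -bigcapI.
Qed.

Lemma cylinder_sub (J J' : {set I}) : J \subset J' -> cylinders J `<=` cylinders J'.
Proof.
move=> JJ' E [B mB ->].
exists (fun i => if i \in J then B i else setT).
  by move=> i; case: ifP.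
apply/seteqP; split => x /= H i /= iJ.
  by case: ifP => // iJ0; exact: H.
by move: (H i (fintype.subsetP JJ' _ iJ)); rewrite /= iJ.
Qed.

Lemma block_sub (J J' : {set I}) E : J \subset J' ->
  measurable (E : set (block J)) -> measurable (E : set (block J')).
Proof.
move=> JJ' mE; have : <<s cylinders J >> `<=` <<s cylinders J' >>.
  by apply: sub_smallest2r; [exact: smallest_sigma_algebra|exact: cylinder_sub].
by apply.
Qed.

Lemma block_measurable J E : measurable (E : set (block J)) -> measurable (E : set Omega).
Proof.
have : <<s cylinders J >> `<=` measurable.
  apply: smallest_sub; first exact: sigma_algebra_measurable.
  exact: cylinder_measurable.
by apply.
Qed.

Lemma block_RV (J : {set I}) i : i \in J -> measurable_fun [set: block J] (X i : block J -> R).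
Proof.
move=> iJ _ B mB; rewrite setTI; apply: sub_sigma_algebra.
exists (fun k => if k == i then B else setT).
  by move=> k; case: ifP.
apply/seteqP; split => x /=.
  by move=> Bx k _ /=; case: eqP => [->|].
by move=> /(_ i iJ); rewrite /= eqxx.
Qed.

Lemma block_fun_sub (J J' : {set I}) (f : Omega -> R) : J \subset J' ->
  measurable_fun [set: block J] (f : block J -> R) ->
  measurable_fun [set: block J'] (f : block J' -> R).
Proof.
by move=> JJ' mf _ B mB; apply: (block_sub JJ'); exact: mf.
Qed.

Lemma block_fun_measurable J (f : Omega -> R) :
  measurable_fun [set: block J] (f : block J -> R) -> measurable_fun [set: Omega] f.
Proof. by move=> mf _ B mB; apply: (@block_measurable J); exact: mf. Qed.

Hypothesis ind : mutually_independent X.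

Lemma cylinder_indep (J J' : {set I}) E F : [disjoint J & J']%B ->
  cylinders J E -> cylinders J' F -> P (E `&` F) = P E * P F.
Proof.
move=> dJ [B mB ->] [B' mB' ->].
(* By disjointness one family [D] describes both cylinders, so their intersection is a cylinder over
   the union of the index sets. *)
pose D i := if i \in J then B i else B' i.
have mD i : measurable (D i) by rewrite /D; case: ifP.
have jJ' i : i \in J' -> i \in J = false.
  by move=> iJ'; apply/negP => iJ; move/pred0P: dJ => /(_ i) /=; rewrite iJ iJ'.
have -> : \bigcap_(i in [set i | i \in J]) (X i @^-1` B i) `&`
    \bigcap_(i in [set i | i \in J']) (X i @^-1` B' i) =
    \bigcap_(i in [set i | i \in (J :|: J')%SET]) (X i @^-1` D i).
  apply/seteqP; split => x /=.
    move=> [H H'] i /=; rewrite finset.in_setU /D; case: ifP => iJ /=; first by move=> _; exact: H.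
    by move=> iJ'; exact: H'.
  move=> H; split => i /= iJ; have := H i; rewrite /= finset.in_setU iJ ?orbT => /(_ isT);
    by rewrite /D ?iJ// jJ'.
rewrite !ind// (eq_bigl [in [predU J & J']]); last by move=> i; rewrite finset.in_setU.
rewrite bigU//=; congr (_ * _); apply: eq_bigr => i iJ; rewrite /D ?iJ//.
by rewrite jJ'.
Qed.

(** The pi-system argument is used twice: it reduces [E] to a cylinder for a fixed [F], then [F] to
    a cylinder for that [E]. *)
Lemma block_indep (J J' : {set I}) E F : [disjoint J & J']%B ->
  measurable (E : set (block J)) -> measurable (F : set (block J')) ->
  P (E `&` F) = P E * P F.
Proof.
move=> dJ mE mF.
have /(_ _ E mE)[|_ ->//] := @pi_system_indep (cylinders J) F
  (@cylinders_setI J) (@cylinder_measurable J) (block_measurable mF).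
move=> {mE} {}E cE; rewrite setIC muleC.
have /(_ _ F mF)[|_ ->//] := @pi_system_indep (cylinders J') E
  (@cylinders_setI J') (@cylinder_measurable J') (cylinder_measurable cE).
by move=> {mF} {}F cF; rewrite setIC muleC; exact: cylinder_indep cE cF.
Qed.

End Blocks.

(** * Expectations of products of independent functions *)

Section Products.
Context {R : realType} {d : measure_display} {Omega : measurableType d}.
Variable P : probability Omega R.
Local Open Scope ereal_scope.

Definition indep_fun (f g : Omega -> R) := forall A B : set R,
  measurable A -> measurable B ->
  P (f @^-1` A `&` g @^-1` B) = P (f @^-1` A) * P (g @^-1` B).

Lemma indep_distribution (f g : {RV P >-> R}) (h : {RV P >-> (R * R)%type}) :
  (h =1 fun w => (f w, g w)) -> indep_fun f g ->
  forall A, measurable A ->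
  (distribution P f \x distribution P g) A = distribution P h A.
Proof.
move=> hE fg; apply: product_measure_unique => A B mA mB.
rewrite /= -fg// /pushforward; congr (P _).
by apply/seteqP; split => w /=; rewrite hE.
Qed.

Lemma ge0_integral_indepM (f g : Omega -> R) :
    measurable_fun setT f -> measurable_fun setT g ->
    (forall w, (0 <= f w)%R) -> (forall w, (0 <= g w)%R) -> indep_fun f g ->
  \int[P]_w (f w * g w)%:E = \int[P]_w (f w)%:E * \int[P]_w (g w)%:E.
Proof.
move=> mf mg f0 g0 fg.
have mfg : measurable_fun setT (fun w => (f w, g w)) by exact: measurable_fun_pair.
pose F : {RV P >-> R} := mfun_Sub (mem_set mf).
pose G : {RV P >-> R} := mfun_Sub (mem_set mg).
pose H : {RV P >-> (R * R)%type} := mfun_Sub (mem_set mfg).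
have law := @indep_distribution F G H (fun=> erefl) fg.
(* Tonelli needs an integrand nonnegative on the whole plane, while [f] and [g] are only known to
   have nonnegative values; hence the absolute values. *)
pose u (z : R * R) : \bar R := (`|z.1| * `|z.2|)%:E.
have mu : measurable_fun setT u.
  apply/measurable_EFinP; apply: measurable_funM; apply: measurableT_comp => //.
have u0 z : 0 <= u z by rewrite lee_fin mulr_ge0.
have -> : \int[P]_w (f w * g w)%:E = \int[distribution P F \x distribution P G]_z u z.
  transitivity (\int[distribution P H]_z u z).
    rewrite ge0_integral_distribution//.
    by apply: eq_integral => w _; rewrite /= /u /= !ger0_norm.
  by apply: eq_measure_integral => A mA _; apply/esym/law.
rewrite fubini_tonelli1// /fubini_F /u /=.
have ma : measurable_fun setT (fun y : R => `|y|%:E).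
  by apply/measurable_EFinP.
under eq_integral do under eq_integral do rewrite EFinM.
under eq_integral => x _ do rewrite ge0_integralZl//.
rewrite ge0_integralZr//; last exact: integral_ge0.
rewrite (ge0_integral_distribution F)// (ge0_integral_distribution G)//.
by congr (_ * _); apply: eq_integral => w _; rewrite /= ger0_norm.
Qed.

Lemma integral_indepM (f g : Omega -> R) :
    P.-integrable setT (EFin \o f) -> P.-integrable setT (EFin \o g) ->
    indep_fun f g -> P.-integrable setT (EFin \o (f \* g)%R) /\
  \int[P]_w (f w * g w)%:E = \int[P]_w (f w)%:E * \int[P]_w (g w)%:E.
Proof.
move=> fi gi fg.
have mf : measurable_fun setT f by apply/measurable_EFinP; exact: measurable_int fi.
have mg : measurable_fun setT g by apply/measurable_EFinP; exact: measurable_int gi.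
have mfg : measurable_fun setT (fun w => (f w, g w)) by exact: measurable_fun_pair.
(* The nonnegative case applied to absolute values gives the integrability that Fubini requires. *)
have iabs : \int[P]_w (`|f w| * `|g w|)%:E < +oo.
  rewrite (@ge0_integral_indepM (fun w => `|f w|%R) (fun w => `|g w|%R))//.
  - rewrite lte_mul_pinfty//; first exact: integral_ge0.
      by rewrite ge0_fin_numE; [move/integrableP: fi => [_]|exact: integral_ge0].
    by move/integrableP: gi => [_].
  - exact: measurableT_comp.
  - exact: measurableT_comp.
  - move=> A B mA mB.
    have mn : measurable_fun setT (fun x : R => `|x|%R) by [].
    have H (C : set R) : measurable C -> measurable ((fun x : R => `|x|%R) @^-1` C).
      by move=> mC; rewrite -[_ @^-1` _]setTI; exact: mn.
    by have := fg _ _ (H A mA) (H B mB).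
have ifg : P.-integrable setT (EFin \o (f \* g)%R).
  apply/integrableP; split; first by apply/measurable_EFinP; exact: measurable_funM.
  rewrite (le_lt_trans _ iabs)// le_eqVlt; apply/orP; left; apply/eqP.
  by apply: eq_integral => w _ /=; rewrite normrM.
split => //.
pose F : {RV P >-> R} := mfun_Sub (mem_set mf).
pose G : {RV P >-> R} := mfun_Sub (mem_set mg).
pose H : {RV P >-> (R * R)%type} := mfun_Sub (mem_set mfg).
have law := @indep_distribution F G H (fun=> erefl) fg.
pose u (z : R * R) : \bar R := (z.1 * z.2)%:E.
have mu : measurable_fun setT u.
  by apply/measurable_EFinP; apply: measurable_funM.
have Hi : P.-integrable setT (u \o H) by [].
have ui : (distribution P F \x distribution P G).-integrable setT u.
  apply/integrableP; split => //.
  rewrite [ltLHS](_ : _ = \int[distribution P H]_z `|u z|); last first.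
    by apply: eq_measure_integral => A mA _; apply: law.
  rewrite ge0_integral_distribution//; last exact: measurableT_comp.
  by move/integrableP: Hi => [_].
have -> : \int[P]_w (f w * g w)%:E = \int[distribution P F \x distribution P G]_z u z.
  transitivity (\int[distribution P H]_z u z); first by rewrite integral_distribution.
  by apply: eq_measure_integral => A mA _; apply/esym/law.
rewrite -integral12_prod_meas1// /fubini_F /u /=.
have mE : measurable_fun setT (EFin : R -> \bar R) by [].
have idG : (distribution P G).-integrable setT (EFin : R -> \bar R).
  apply/integrableP; split => //.
  rewrite ge0_integral_distribution//; last exact: measurableT_comp.
  by move/integrableP: gi => [_].
have idF : (distribution P F).-integrable setT (EFin : R -> \bar R).
  apply/integrableP; split => //.
  rewrite ge0_integral_distribution//; last exact: measurableT_comp.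
  by move/integrableP: fi => [_].
under eq_integral do under eq_integral do rewrite EFinM.
under eq_integral => x _ do rewrite integralZl//.
have EG : \int[distribution P G]_y y%:E = \int[P]_w (g w)%:E by rewrite integral_distribution.
have EF : \int[distribution P F]_y y%:E = \int[P]_w (f w)%:E by rewrite integral_distribution.
have cfin : \int[P]_w (g w)%:E \is a fin_num by exact: integrable_fin_num.
transitivity (\int[distribution P F]_x (x%:E * (fine (\int[P]_w (g w)%:E))%:E)).
  by apply: eq_integral => x _; rewrite fineK// -EG.
by rewrite integralZr// EF fineK.
Qed.

Variables (I : finType) (X : I -> {RV P >-> R}).
Hypothesis ind : mutually_independent X.

Lemma block_indep_fun (J J' : {set I}) (f g : Omega -> R) : [disjoint J & J']%B ->
  measurable_fun [set: block X J] (f : block X J -> R) ->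
  measurable_fun [set: block X J'] (g : block X J' -> R) -> indep_fun f g.
Proof.
move=> dJ mf mg A B mA mB; apply: (block_indep ind dJ).
  by have := mf measurableT A mA; rewrite setTI.
by have := mg measurableT B mB; rewrite setTI.
Qed.

(** Induction on the list: the product over the tail is measurable for the union of its blocks,
    which is still disjoint from the block of the head. *)
Lemma ge0_integral_block_prod (T : eqType) (r : seq T) (J : T -> {set I})
    (f : T -> Omega -> R) : uniq r ->
    {in r &, forall i j, i != j -> [disjoint J i & J j]%B} ->
    (forall i, i \in r -> measurable_fun [set: block X (J i)] (f i : block X (J i) -> R)) ->
    (forall i w, (0 <= f i w)%R) ->
  \int[P]_w (\prod_(i <- r) f i w)%:E = \prod_(i <- r) \int[P]_w (f i w)%:E.
Proof.
move=> + + + f0; elim: r => [|a r IH] /=.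
  by move=> _ _ _; under eq_integral do rewrite big_nil; rewrite big_nil integral_cst// mul1e; exact: probability_setT.
move=> /andP[ar ur] dJ mf; rewrite big_cons -IH//; first last.
- by move=> i ir; apply: mf; rewrite inE ir orbT.
- by move=> i j ir jr; apply: dJ; rewrite inE ?ir ?jr orbT.
under eq_integral do rewrite big_cons.
pose K := (\bigcup_(i <- r) J i)%SET.
have sK i : i \in r -> J i \subset K.
  by move=> ir; rewrite /K (big_rem i)//= finset.subsetUl.
have mprod : measurable_fun [set: block X K] ((fun w => \prod_(i <- r) f i w)%R : block X K -> R).
  apply: measurable_prod => i ir; apply: (block_fun_sub (sK i ir)).
  by apply: mf; rewrite inE ir orbT.
apply: (@ge0_integral_indepM (f a) (fun w => \prod_(i <- r) f i w)%R) => //.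
- by apply: block_fun_measurable (mf a _); rewrite inE eqxx.
- exact: block_fun_measurable mprod.
- by move=> w; apply: prodr_ge0.
- apply: (block_indep_fun (J := J a) (J' := K)) => //; last by apply: mf; rewrite inE eqxx.
  rewrite disjoint_sym /K.
  have : {in r, forall i, [disjoint J a & J i]%B}.
    move=> i ir; apply: dJ; rewrite ?inE ?eqxx ?ir ?orbT//.
    by apply: contra ar => /eqP ->.
  move: (r) => r0; elim: r0 => [|b r0 IHr] H.
    by rewrite big_nil -setI_eq0 finset.set0I.
  rewrite big_cons -setI_eq0 finset.setIUl finset.setU_eq0 !setI_eq0 IHr; last first.
    by move=> i ir; apply: H; rewrite inE ir orbT.
  by rewrite andbT disjoint_sym H// inE eqxx.
Qed.

End Products.

(** * Quadratic defect, rounding to a grid, and the restricted isometry constant *)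

Section RestrictedIsometry.
Context {R : realType}.

Lemma sqnorm_ge0 k (v : 'cV[R]_k) : 0 <= sqnorm v.
Proof. by apply: sumr_ge0 => i _; exact: sqr_ge0. Qed.

Lemma sqnormZ k (t : R) (v : 'cV[R]_k) : sqnorm (t *: v) = t ^+ 2 * sqnorm v.
Proof. by rewrite /sqnorm mulr_sumr; apply: eq_bigr => i _; rewrite mxE exprMn. Qed.

Lemma sqnorm_parallelogram k (x y : 'cV[R]_k) :
  sqnorm (x + y) + sqnorm (x - y) = 2 * (sqnorm x + sqnorm y).
Proof.
rewrite /sqnorm -!big_split /= mulr_sumr; apply: eq_bigr => i _; rewrite !mxE; ring.
Qed.

(** With [u = a (x - y)] and [v = (x + y) / 2], both sides come from [|u + v|^2 - |u - v|^2 = 4 <u,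
    v> = 2 a <x - y, x + y>]. *)
Lemma sqnorm_polar k (a : R) (x y : 'cV[R]_k) : a != 0 ->
  sqnorm x - sqnorm y = (2 * a)^-1 *
    (sqnorm (a *: (x - y) + 2^-1 *: (x + y)) - sqnorm (a *: (x - y) - 2^-1 *: (x + y))).
Proof.
move=> a0; rewrite /sqnorm -!sumrB mulr_sumr; apply: eq_bigr => i _; rewrite !mxE.
by field; rewrite a0.
Qed.

Lemma sqnorm0_eq0 k (z : 'cV[R]_k) : sqnorm z = 0 -> z = 0.
Proof.
move=> /eqP; rewrite psumr_eq0 => [/allP z0|i _]; last exact: sqr_ge0.
apply/colP => i; rewrite mxE; apply/eqP; rewrite -sqrf_eq0.
by have := z0 i; rewrite mem_index_enum => /(_ isT).
Qed.

Definition defect k N (B : 'M[R]_(k, N)) (z : 'cV[R]_N) : R :=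
  sqnorm (B *m z) - sqnorm z.

Section Defect.
Context {k N : nat}.
Variable B : 'M[R]_(k, N).

Lemma defectZ (t : R) z : defect B (t *: z) = t ^+ 2 * defect B z.
Proof. by rewrite /defect -scalemxAr !sqnormZ mulrBr. Qed.

Lemma defect_polar (a : R) (x y : 'cV[R]_N) : a != 0 ->
  defect B x - defect B y = (2 * a)^-1 *
    (defect B (a *: (x - y) + 2^-1 *: (x + y)) - defect B (a *: (x - y) - 2^-1 *: (x + y))).
Proof.
move=> a0.
have := sqnorm_polar x y a0; have := sqnorm_polar (B *m x) (B *m y) a0.
rewrite -mulmxBr -mulmxDr !scalemxAr -mulmxBr -mulmxDr /defect => e1 e2.
transitivity ((sqnorm (B *m x) - sqnorm (B *m y)) - (sqnorm x - sqnorm y)); first ring.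
rewrite e1 e2; ring.
Qed.

Definition supported (S : {set 'I_N}) (z : 'cV[R]_N) := forall i, i \notin S -> z i 0 = 0.

(** The crude [M] serves to make suprema of the defect finite: a self-bounding inequality for a
    supremum says nothing about an infinite one. *)
Lemma defect_bounded : exists M : R, forall z, sqnorm z <= 1 -> `|defect B z| <= M.
Proof.
exists (\sum_i (\sum_j `|B i j|) ^+ 2 + 1) => z z1.
rewrite (le_trans (ler_normB _ _))// (ger0_norm (sqnorm_ge0 _)) (ger0_norm (sqnorm_ge0 _)).
rewrite lerD//; apply: ler_sum => i _; rewrite -[leLHS]real_normK ?num_real//.
rewrite lerXn2r ?nnegrE ?sumr_ge0// mxE (le_trans (ler_norm_sum _ _ _))//.
apply: ler_sum => j _; rewrite normrM ler_piMr//.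
rewrite -(@ler_pXn2r _ 2) ?nnegrE// expr1n real_normK ?num_real//.
rewrite (le_trans _ z1)// /sqnorm (bigD1 j)//= lerDl.
by apply: sumr_ge0 => l _; exact: sqr_ge0.
Qed.

(** Homogeneity of degree two; needed because the vectors [u + v] and [u - v] of the polarisation
    may leave the unit ball. *)
Lemma defect_scale (S : {set 'I_N}) (r : R) :
  (forall z, supported S z -> sqnorm z <= 1 -> `|defect B z| <= r) ->
  forall z, supported S z -> `|defect B z| <= r * sqnorm z.
Proof.
move=> H z Sz; have [/sqnorm0_eq0 ->|z0] := eqVneq (sqnorm z) 0.
  by rewrite -(scale0r 0) defectZ sqnormZ expr0n/= !mul0r normr0 mulr0.
have zp : 0 < sqnorm z by rewrite lt_neqAle eq_sym z0 sqnorm_ge0.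
pose t := Num.sqrt (sqnorm z).
have t2 : t ^+ 2 = sqnorm z by rewrite sqr_sqrtr// ltW.
have := H (t^-1 *: z); rewrite defectZ sqnormZ exprVn t2 mulVf//.
rewrite normrM ger0_norm ?invr_ge0 ?sqnorm_ge0// ler_pdivrMl// mulrC.
apply => // i iS; by rewrite mxE Sz ?mulr0.
Qed.

End Defect.

Lemma l0normE N (z : 'cV[R]_N) : l0norm z = #|[set i | z i 0 != 0]%SET|.
Proof. by apply: eq_card => i; rewrite [RHS]inE; apply/idP/idP; rewrite inE. Qed.

(** Such a vector forces every admissible constant in [ric] to be nonnegative, so that the infimum
    is over a set bounded below. *)
Lemma exists_unit_sparse N s : (0 < N)%N -> (0 < s)%N ->
  exists2 e : 'cV[R]_N, sqnorm e = 1 & (l0norm e <= s)%N.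
Proof.
move=> N0 s0; exists (delta_mx (Ordinal N0) 0).
  rewrite /sqnorm (bigD1 (Ordinal N0))//= big1 ?addr0 => [|i /negPf ne].
    by rewrite mxE !eqxx expr1n.
  by rewrite mxE ne expr0n.
rewrite l0normE (leq_trans _ s0)// -[leqRHS](card1 (Ordinal N0)); apply/subset_leq_card.
apply/fintype.subsetP => i; rewrite !inE /= mxE andbT.
by case: (i == _) => //; rewrite eqxx.
Qed.

Section Net.
Context {N : nat} (a s : nat).

Definition grid := {ffun 'I_N -> bool * 'I_(a * s).+1}.

Definition gridvec (g : grid) : 'cV[R]_N :=
  \col_i ((-1) ^+ (g i).1 * (g i).2%:R / (a%:R * Num.sqrt s%:R)).

(** The bound on the sum keeps the net small, the sign clause gives zero a single code for the
    count, and the norm clause keeps projections on grid vectors subGaussian with parameter [c]. *)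
Definition in_net (g : grid) : bool :=
  [&& (#|[set i | (g i).2 != 0 :> nat]%SET| <= s)%N, (\sum_i (g i).2 <= a * s)%N,
      [forall i, ((g i).2 == 0 :> nat) ==> ~~ (g i).1] & sqnorm (gridvec g) <= 1].

(** Truncating each coordinate towards zero preserves support and norm bound; an error of at most
    [1 / (a sqrt s)] on at most [s] coordinates has norm at most [1 / a]. *)
Lemma rounding (S : {set 'I_N}) (z : 'cV[R]_N) : (0 < a)%N -> (0 < s)%N ->
  (#|S| <= s)%N -> supported S z -> sqnorm z <= 1 ->
  exists2 g : grid, in_net g &
    [/\ supported S (gridvec g), sqnorm (a%:R *: (z - gridvec g)) <= 1 &
        sqnorm (2^-1 *: (z + gridvec g)) <= 1].
Proof.
move=> a0 s0 Ss Sz z1.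
pose q : R := Num.sqrt s%:R.
have q0 : 0 < q by rewrite sqrtr_gt0 ltr0n.
have q2 : q ^+ 2 = s%:R by rewrite sqr_sqrtr.
have aR : 0 < a%:R :> R by rewrite ltr0n.
pose u : R := a%:R * q.
have u0 : 0 < u by rewrite mulr_gt0.
pose t i := Num.truncn (u * `|z i 0|).
have tle i : (t i)%:R <= u * `|z i 0| by rewrite truncn_le mulr_ge0// ltW.
have tgt i : u * `|z i 0| < (t i)%:R + 1 by rewrite natr1 truncnS_gt.
have tS i : i \notin S -> t i = 0%N.
  by move=> iS; rewrite /t Sz// normr0 mulr0 truncn0.
(* Cauchy-Schwarz, obtained by summing the arithmetic-geometric inequality balanced at
   [|z i 0| = 1 / q], with [#|S| <= q ^+ 2]. *)
have sumz : \sum_(i in S) `|z i 0| <= q.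
  have amgm i : `|z i 0| <= (q * z i 0 ^+ 2 + q^-1) / 2.
    rewrite ler_pdivlMr// -(ler_pM2l q0) [leRHS]mulrDr divff ?gt_eqF// [in leRHS]mulrA.
    rewrite -[z i 0 ^+ 2]real_normK ?num_real//.
    by have := sqr_ge0 (q * `|z i 0| - 1); rewrite sqrrB; lra.
  apply: (@le_trans _ _ (\sum_(i in S) ((q * z i 0 ^+ 2 + q^-1) / 2))).
    by apply: ler_sum => i _; exact: amgm.
  rewrite -mulr_suml big_split /= -mulr_sumr sumr_const.
  have A1 : \sum_(i in S) z i 0 ^+ 2 <= 1.
    rewrite (le_trans _ z1)// /sqnorm [leRHS](bigID (mem S))/= lerDl.
    by apply: sumr_ge0 => i _; exact: sqr_ge0.
  have A2 : q^-1 *+ #|S| <= q.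
    rewrite -mulr_natr -(ler_pM2l q0) mulrA divff ?gt_eqF// mul1r -expr2 q2.
    by rewrite ler_nat.
  have := ler_wpM2l (ltW q0) A1; lra.
have sumt : (\sum_i t i <= a * s)%N.
  rewrite -(@ler_nat R) natr_sum natrM -q2 expr2 mulrA.
  rewrite (bigID (mem S))/= [X in _ + X]big1 ?addr0; last by move=> i /tS ->.
  apply: (@le_trans _ _ (\sum_(i in S) u * `|z i 0|)); first exact: ler_sum.
  by rewrite -mulr_sumr ler_wpM2l// ltW.
have tlt i : (t i < (a * s).+1)%N.
  by rewrite ltnS (leq_trans _ sumt)// (bigD1 i)//= leq_addr.
pose g : grid := [ffun i => ((z i 0 < 0) && (t i != 0)%N, Ordinal (tlt i))].
have gE i : gridvec g i 0 = (-1) ^+ (z i 0 < 0)%R * (t i)%:R / u.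
  rewrite mxE ffunE /=; have [->|t0] := eqVneq (t i) 0%N; first by rewrite !mulr0.
  by rewrite andbT.
have zE i : z i 0 = (-1) ^+ (z i 0 < 0)%R * `|z i 0| by rewrite -realEsign ?num_real.
have sg2 i : ((-1) ^+ (z i 0 < 0)%R) ^+ 2 = 1 :> R by rewrite sqrr_sign.
have vle i : (t i)%:R / u <= `|z i 0| by rewrite ler_pdivrMr// mulrC.
have vge i : 0 <= (t i)%:R / u by rewrite divr_ge0// ltW.
have vgt i : a%:R * (`|z i 0| - (t i)%:R / u) <= q^-1.
  rewrite -(ler_pM2l q0) divff ?gt_eqF//.
  rewrite [leLHS](_ : _ = u * `|z i 0| - (t i)%:R); last by rewrite /u; field; rewrite !gt_eqF.
  by have := tgt i; lra.
have Sg : supported S (gridvec g).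
  by move=> i iS; rewrite gE tS// mulr0 mul0r.
(* A coordinate and its rounding carry the same sign, so quadratic expressions in the two may be
   evaluated on absolute values. *)
have coord i (h : R -> R -> R) : (forall (e x y : R), h (e * x) (e * y) = e ^+ 2 * h x y) ->
    h (z i 0) (gridvec g i 0) = h `|z i 0| ((t i)%:R / u).
  by move=> hh; rewrite gE {1}zE -mulrA hh sg2 mul1r.
have sqv i : gridvec g i 0 ^+ 2 <= z i 0 ^+ 2.
  rewrite (coord i (fun x y => y ^+ 2)) ?(coord i (fun x y => x ^+ 2)); [|by move=> *; ring..].
  by rewrite lerXn2r ?nnegrE.
exists g; first (apply/and4P; split).
- rewrite (leq_trans _ Ss)// subset_leq_card//; apply/fintype.subsetP => i.
  by rewrite inE ffunE /=; apply: contraR => /tS ->.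
- by under eq_bigr do rewrite ffunE.
- by apply/forallP => i; rewrite ffunE /=; apply/implyP => /eqP ->; rewrite eqxx andbF.
- by rewrite (le_trans _ z1)//; apply: ler_sum => i _; exact: sqv.
have zvE i : (a%:R *: (z - gridvec g)) i 0 = a%:R * (z i 0 - gridvec g i 0) by rewrite !mxE.
split => //.
- rewrite /sqnorm (bigID (mem S))/= [X in _ + X]big1 ?addr0; last first.
    by move=> i iS; rewrite zvE Sz// Sg// subrr mulr0 expr0n.
  apply: (@le_trans _ _ (\sum_(i in S) (q^-1) ^+ 2)).
    apply: ler_sum => i _; rewrite zvE.
    rewrite (coord i (fun x y => (a%:R * (x - y)) ^+ 2)); last by move=> *; ring.
    by rewrite lerXn2r ?nnegrE ?invr_ge0 ?(ltW q0) ?mulr_ge0// subr_ge0.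
  rewrite sumr_const exprVn q2 -[leLHS]mulr_natr ler_pdivrMl ?ltr0n// mulr1.
  by rewrite ler_nat.
- rewrite (le_trans _ z1)//; apply: ler_sum => i _.
  have -> : (2^-1 *: (z + gridvec g)) i 0 = 2^-1 * (z i 0 + gridvec g i 0) by rewrite !mxE.
  rewrite (coord i (fun x y => (2^-1 * (x + y)) ^+ 2)); last by move=> *; ring.
  rewrite -[leRHS]real_normK ?num_real// lerXn2r ?nnegrE//.
    by rewrite mulr_ge0// addr_ge0.
  by have := vle i; lra.
Qed.

(* The supremum [r] of the defect satisfies [r <= eta + 2 r / a], by polarisation
   between a vector and its rounding. *)
Lemma net_bound k (B : 'M[R]_(k, N)) (eta : R) : (2 < a)%N -> (0 < s)%N ->
  (forall g, in_net g -> `|defect B (gridvec g)| <= eta) ->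
  forall z, (l0norm z <= s)%N -> `|defect B z| <= eta / (1 - 2 / a%:R) * sqnorm z.
Proof.
move=> a2 s0 H z; set S := [set i | z i 0 != 0]%SET.
rewrite l0normE -/S => Ss.
have aR : 2 < a%:R :> R by rewrite ltr_nat.
have a0 : (a%:R : R) != 0 by rewrite gt_eqF//; lra.
have a0' : (0 < a)%N by exact: ltn_trans a2.
pose E : set R := [set x | exists z, [/\ supported S z, sqnorm z <= 1 & x = `|defect B z|]].
have [M HM] := defect_bounded B.
have ubE : has_ubound E by exists M => x [y [_ y1 ->]]; exact: HM.
have supE y : supported S y -> sqnorm y <= 1 -> `|defect B y| <= sup E.
  by move=> Sy y1; apply: ub_le_sup => //; exists y.
have E0 : E !=set0.
  exists `|defect B 0|, 0; split => //; first by move=> i _; rewrite mxE.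
  by rewrite -(scale0r 0) sqnormZ expr0n mul0r.
have scl := defect_scale supE.
have key : sup E <= eta + 2 * sup E / a%:R.
  apply: ge_sup => // _ [y [Sy y1 ->]].
  have [g gn [Sg d1 d2]] := rounding a0' s0 Ss Sy y1.
  have Hg := H g gn; move: (gridvec g) Sg d1 d2 Hg => v Sg d1 d2 Hg.
  rewrite -[defect B y](subrK (defect B v)) addrC (le_trans (ler_normD _ _))//.
  rewrite lerD//.
  rewrite (defect_polar B y v a0) normrM ger0_norm; last by rewrite invr_ge0; lra.
  rewrite ler_pdivrMl ?mulr_gt0//; last by lra.
  rewrite [leRHS](_ : _ = 4 * sup E); last by field.
  (* Only the sum of the squared norms of [x1 + x2] and [x1 - x2] is needed; the parallelogram law
     bounds it by [4]. *)
  set x1 := a%:R *: (y - v) in d1 *; set x2 := 2^-1 *: (y + v) in d2 *.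
  have Sx1 : supported S x1 by move=> i iS; rewrite !mxE Sy// Sg// subrr mulr0.
  have Sx2 : supported S x2 by move=> i iS; rewrite !mxE Sy// Sg// addr0 mulr0.
  clearbody x1 x2; have h1 : `|defect B (x1 + x2)| <= sup E * sqnorm (x1 + x2).
    by apply: scl => i iS; rewrite mxE Sx1// Sx2// addr0.
  have h2 : `|defect B (x1 - x2)| <= sup E * sqnorm (x1 - x2).
    by apply: scl => i iS; rewrite !mxE Sx1// Sx2// subrr.
  rewrite (le_trans (ler_normB _ _))// (le_trans (lerD h1 h2))//.
  rewrite -mulrDr sqnorm_parallelogram.
  have r0 : 0 <= sup E by rewrite (le_trans _ (supE y Sy y1)).
  have : sup E * (sqnorm x1 + sqnorm x2) <= sup E * 2 by rewrite ler_wpM2l//; lra.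
  lra.
have c0 : 0 < 1 - 2 / a%:R :> R.
  by rewrite subr_gt0 ltr_pdivrMr ?mul1r//; lra.
have Sz : supported S z by move=> i; rewrite inE negbK => /eqP.
rewrite (le_trans (scl z Sz))// ler_wpM2r ?sqnorm_ge0//.
rewrite ler_pdivlMr//; lra.
Qed.

End Net.

Lemma ric_defect k N (B : 'M[R]_(k, N)) s :
  ric B s = inf [set d | forall z, sqnorm z = 1 -> (l0norm z <= s)%N -> `|defect B z| <= d].
Proof.
rewrite /ric; congr inf; apply/seteqP; split => d /= H z z1 zs.
  by move: (H z z1 zs); rewrite /defect z1 ler_norml => /andP[? ?]; apply/andP; split; lra.
by move: (H z z1 zs); rewrite /defect z1 ler_norml => /andP[? ?]; apply/andP; split; lra.
Qed.

Lemma ric_lt_of_bound k N (B : 'M[R]_(k, N)) s (c delta : R) : (0 < N)%N -> (0 < s)%N ->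
  c < delta -> (forall z, sqnorm z = 1 -> (l0norm z <= s)%N -> `|defect B z| <= c) ->
  ric B s < delta.
Proof.
move=> N0 s0 cd H; rewrite (le_lt_trans _ cd)// ric_defect; apply: ge_inf => //.
exists 0 => x /= Hx; have [e e1 es] := exists_unit_sparse N0 s0.
exact: le_trans (Hx e e1 es).
Qed.

Lemma bound_of_ric_lt k N (B : 'M[R]_(k, N)) s (delta : R) : ric B s < delta ->
  exists2 c, c < delta & forall z, sqnorm z = 1 -> (l0norm z <= s)%N -> `|defect B z| <= c.
Proof.
rewrite ric_defect => /inf_lt[|c Hc cd]; last by exists c.
by have [M HM] := defect_bounded B; exists M => z z1 _; apply: HM; rewrite z1.
Qed.

(* Membership in the event [ric < delta] is decided by countably many finite nets,
   which is what makes the event measurable. *)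
Lemma ric_ltP k N (B : 'M[R]_(k, N)) s (delta : R) : (0 < N)%N -> (0 < s)%N ->
  ric B s < delta <-> exists n : nat, forall g : @grid N n.+3 s,
    in_net g -> `|defect B (gridvec g)| <= delta - (2 * `|delta| + 1) / n.+3%:R.
Proof.
move=> N0 s0; split => [/bound_of_ric_lt[c cd H]|[n Hn]].
- pose n := Num.truncn ((2 * `|delta| + 1) / (delta - c)).
  have nlt : (2 * `|delta| + 1) / (delta - c) < n.+1%:R by exact: truncnS_gt.
  have dc : 0 < delta - c by rewrite subr_gt0.
  have D0 : 0 <= `|delta| by [].
  have cle : c <= delta - (2 * `|delta| + 1) / n.+3%:R.
    rewrite lerBrDr -lerBrDl ler_pdivrMr// [leRHS]mulrC -ler_pdivrMr//.
    by rewrite (le_trans (ltW nlt))// ler_nat; lia.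
  exists n => g /and4P[gS _ _ g1]; rewrite (le_trans _ cle)//.
  set v := gridvec g in g1 *.
  have ls : (l0norm v <= s)%N.
    rewrite l0normE (leq_trans _ gS)// subset_leq_card//; apply/fintype.subsetP => i.
    rewrite !inE /= mxE; apply: contra => /eqP ->.
    by rewrite mulr0 mul0r.
  (* The hypothesis concerns unit vectors, so grid vectors are normalised; the zero vector is
     covered by [0 <= c]. *)
  have [/sqnorm0_eq0 v0|v0] := eqVneq (sqnorm v) 0.
    have c0 : 0 <= c.
      have [e e1 es] := exists_unit_sparse N0 s0.
      exact: le_trans (H e e1 es).
    by rewrite v0 -(scale0r 0) defectZ expr0n mul0r normr0.
  have vp : 0 < sqnorm v by rewrite lt_neqAle eq_sym v0 sqnorm_ge0.
  pose t := Num.sqrt (sqnorm v).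
  have t2 : t ^+ 2 = sqnorm v by rewrite sqr_sqrtr// ltW.
  have t0 : t != 0 by rewrite -sqrf_eq0 t2.
  have := H (t^-1 *: v); rewrite sqnormZ defectZ exprVn t2 mulVf// => /(_ erefl).
  have -> : l0norm (t^-1 *: v) = l0norm v.
    by rewrite !l0normE; apply: eq_card => i; rewrite !inE mxE mulf_eq0 invr_eq0 (negPf t0).
  move=> /(_ ls); rewrite normrM ger0_norm ?invr_ge0 ?sqnorm_ge0// ler_pdivrMl//.
  move=> h; rewrite (le_trans h)// ler_piMl//.
  by rewrite -(pmulr_rge0 _ vp) (le_trans _ h).
- have aR : 0 < n.+3%:R :> R by [].
  have a3 : 3 <= n.+3%:R :> R by rewrite ler_nat.
  have HB := net_bound (isT : (2 < n.+3)%N) s0 Hn.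
  (* Clearing the denominator reduces the strict inequality to [2 * delta < 2 * |delta| + 1], which
     dictates the margin; [n.+3] keeps [1 - 2 / a] positive. *)
  apply: (ric_lt_of_bound (c := (delta - (2 * `|delta| + 1) / n.+3%:R) / (1 - 2 / n.+3%:R))) => //.
    rewrite ltr_pdivrMr; last by rewrite subr_gt0 ltr_pdivrMr// mul1r; lra.
    rewrite mulrBr mulr1 ltrD2l ltrN2 mulrA ltr_pM2r ?invr_gt0//.
    by have := ler_norm delta; lra.
  by move=> z z1 zs; have := HB z zs; rewrite z1 mulr1.
Qed.

End RestrictedIsometry.

(** * Cardinality of the net by a weight argument *)

Section NetCardinality.
Context {R : realType}.

(** A nonzero coordinate costs a factor [l], each unit of magnitude a factor [1/2]; the code of zero
    excluded by [in_net] has weight [0]. *)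
Definition grid_weight (n : nat) (l : R) (x : bool * 'I_n.+1) : R :=
  if x.2 == 0 :> nat then (~~ x.1)%:R else l * 2^-1 ^+ x.2.

Lemma sum_grid_weight n (l : R) : 0 <= l -> \sum_x @grid_weight n l x <= 1 + 2 * l.
Proof.
move=> l0; rewrite -(pair_bigA_idem _ (fun b k => grid_weight l (b, k)))//= ?addr0//.
rewrite big_bool /= !big_ord_recl /grid_weight /=.
have E : \sum_(i < n) l * 2^-1 ^+ (bump 0 i) = l * (1 - 2^-1 ^+ n).
  rewrite -mulr_sumr; congr (_ * _); elim: n => [|n IH]; first by rewrite big_ord0 subrr.
  by rewrite big_ord_recr /= IH /bump /= add1n exprS; field.
have := E; rewrite /grid_weight /= => ->.
have : 0 <= l * 2^-1 ^+ n by rewrite mulr_ge0// exprn_ge0.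
lra.
Qed.

(* The weight [l ^ #supp * 2 ^ - sum] of a net point is at least [l ^ s * 2 ^ (- 4 s)],
   while the total weight of the grid factorises over the coordinates;
   [l := s / (2 N)]. *)
Lemma card_net N s : (0 < s <= N)%N ->
  #|[pred g : @grid N 4 s | @in_net R N 4 s g]|%:R <=
  (expR 1 * N%:R / s%:R) ^+ s * 32 ^+ s :> R.
Proof.
move=> /andP[s0 sN].
have sR : 0 < s%:R :> R by rewrite ltr0n.
have NR : 0 < N%:R :> R by rewrite ltr0n (leq_trans s0).
pose l : R := s%:R / (2 * N%:R).
have l0 : 0 < l by rewrite divr_gt0// mulr_gt0.
have l1 : l <= 1.
  rewrite ler_pdivrMr ?mulr_gt0// mul1r.
  by have : s%:R <= N%:R :> R; [rewrite ler_nat|lra].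
have wge (g : @grid N 4 s) : 0 <= \prod_i grid_weight l (g i).
  apply: prodr_ge0 => i _; rewrite /grid_weight; case: ifP => // _.
  by rewrite mulr_ge0 ?exprn_ge0// ltW.
have wnet (g : @grid N 4 s) : @in_net R N 4 s g ->
    l ^+ s * 2^-1 ^+ (4 * s) <= \prod_i grid_weight l (g i).
  move=> /and4P[gS gsum /forallP gz _].
  have -> : \prod_i grid_weight l (g i) =
      (\prod_i if (g i).2 != 0 :> nat then l else 1) * \prod_i 2^-1 ^+ (g i).2.
    rewrite -big_split /=; apply: eq_bigr => i _; rewrite /grid_weight.
    have := gz i; case: eqP => [-> /= ->|_ _] //=.
    by rewrite expr0 mulr1.
  rewrite -big_mkcond /= prodr_const -expr_sum.
  apply: ler_pM; rewrite ?exprn_ge0 ?(ltW l0)//.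
    apply: ler_wiXn2l; rewrite ?(ltW l0)//.
    by rewrite (leq_trans _ gS)// subset_leq_card//; apply/fintype.subsetP => i; rewrite !inE.
  by apply: ler_wiXn2l => //; lra.
have tot : \sum_(g : @grid N 4 s) \prod_i grid_weight l (g i) <= expR s%:R.
  rewrite -(bigA_distr_bigA (fun (_ : 'I_N) x => grid_weight l x)) prodr_const card_ord.
  have S0 : 0 <= \sum_x @grid_weight (4 * s) l x.
    apply: sumr_ge0 => x _; rewrite /grid_weight; case: ifP => // _.
    by rewrite mulr_ge0 ?exprn_ge0// ltW.
  (* Since [2 * l = s / N], each coordinate contributes at most [1 + s / N], and the power [N]
     cancels the denominator. *)
  apply: (@le_trans _ _ (expR (s%:R / N%:R) ^+ N)).
    rewrite lerXn2r ?nnegrE ?expR_ge0// (le_trans (sum_grid_weight _ (ltW l0)))//.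
    rewrite (le_trans _ (expR_ge1Dx _))// lerD2l /l.
    by rewrite [leLHS](_ : _ = s%:R / N%:R)//; field; rewrite gt_eqF.
  by rewrite -expRM_natl [_ * (_ / _)]mulrC divfK ?gt_eqF.
have c0 : 0 < l ^+ s * 2^-1 ^+ (4 * s) by rewrite mulr_gt0 ?exprn_gt0.
rewrite -(ler_pM2r c0) (@le_trans _ _ (expR s%:R))//.
  rewrite (le_trans _ tot)// -sum1_card natr_sum mulr_suml.
  rewrite (bigID (@in_net R N 4 s) xpredT)/= -[leLHS]addr0 lerD//; last first.
    by apply: sumr_ge0 => g _; exact: wge.
  by apply: ler_sum => g gn; rewrite mul1r; exact: wnet.
(* Origin of [32]: the inverse of the minimal weight is the [s]-th power of
   [2 ^ 4 / l = 32 N / s]. *)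
rewrite exprM -!exprMn -[s%:R as X in expR X]mulr1 expRM_natl.
rewrite lerXn2r ?nnegrE ?expR_ge0//.
  by rewrite !mulr_ge0 ?expR_ge0 ?exprn_ge0 ?invr_ge0// ltW.
rewrite le_eqVlt; apply/orP; left; apply/eqP; rewrite /l.
by field; rewrite !gt_eqF.
Qed.

End NetCardinality.

(** * Exponential moments of squares of subGaussian variables *)

Section Moments.
Context {R : realType}.

(** Rests on [exp v - 1 <= v * exp v], which is [1 - v <= exp (- v)] multiplied by [exp v]. Keeping
    the exact linear term lets centring remove it later. *)
Lemma expR_le_taylor1 (u : R) : expR u <= 1 + u + u ^+ 2 * expR `|u|.
Proof.
have key (v : R) : expR v - 1 <= v * expR v.
  have := expR_ge1Dx (- v); rewrite expRN => h.
  have := ler_wpM2r (expR_ge0 v) h; rewrite mulVf ?gt_eqF ?expR_gt0//.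
  by rewrite mulrDl mul1r mulNr; lra.
have [u0|u0] := leP 0 u.
  rewrite ger0_norm//; have h := key u; have := ler_wpM2l u0 h.
  by rewrite mulrA -expr2; lra.
have h := key u; rewrite ltr0_norm//.
have h2 : u * expR u - u <= u ^+ 2.
  have := expR_ge1Dx u => h3.
  have : 0 <= - u * (expR u - 1 - u) by rewrite mulr_ge0//; lra.
  by rewrite expr2; lra.
have : u ^+ 2 * 1 <= u ^+ 2 * expR (- u).
  by rewrite ler_wpM2l ?sqr_ge0// -expR0 ler_expR; lra.
lra.
Qed.

Lemma sqr_le_expR (b t : R) : 0 < b -> 0 <= t -> t ^+ 2 <= 4 / b ^+ 2 * expR (b * t).
Proof.
move=> b0 t0; rewrite mulrAC ler_pdivlMr ?exprn_gt0//.
have -> : b * t = b * t / 2 + b * t / 2 by field.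
rewrite expRD; have bt : 0 <= b * t by rewrite mulr_ge0// ltW.
have h : b * t / 2 <= expR (b * t / 2) by have := expR_ge1Dx (b * t / 2); lra.
have := ler_pM _ _ h h; rewrite !divr_ge0// => /(_ isT isT).
have -> : t ^+ 2 * b ^+ 2 = 4 * (b * t / 2 * (b * t / 2)) by field.
lra.
Qed.

Context {d : measure_display} {Omega : measurableType d}.
Variable P : probability Omega R.

(** A quarter of [1 / (4 c)], the critical rate for the square of a centred Gaussian of variance
    [2 c]. *)
Definition sq_rate (c : R) : R := (16 * c)^-1.

(** Sum of the geometric series with first term [2 exp (1 / (8 c))] and ratio
    [exp (- 1 / (8 c))]. *)
Definition sq_moment (c : R) : R :=
  2 * expR (8 * c)^-1 / (1 - expR (- (8 * c)^-1)).

(* [exp (a y^2)] is dominated by the term of index [floor |y|] of a series of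
   exponential moments, evaluated at the optimal rate [k / (2 c)]. *)
Lemma expR_sqr_le_series (c y : R) (k : nat) : 0 < c -> k = Num.truncn `|y| ->
  expR (sq_rate c * y ^+ 2) <=
  expR (sq_rate c * (k%:R + 1) ^+ 2 - k%:R ^+ 2 / (2 * c)) *
    (expR (k%:R / (2 * c) * y) + expR (- (k%:R / (2 * c)) * y)).
Proof.
move=> c0 kE; have /andP[kle klt] := truncn_itv (normr_ge0 y).
rewrite -kE -natr1 in kle klt.
have k0 : 0 <= k%:R / (2 * c) :> R by rewrite divr_ge0// mulr_ge0// ltW.
have h1 : expR (k%:R ^+ 2 / (2 * c)) <=
    expR (k%:R / (2 * c) * y) + expR (- (k%:R / (2 * c)) * y).
  have E : k%:R ^+ 2 / (2 * c) = k%:R / (2 * c) * k%:R by field; rewrite gt_eqF.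
  have h := ler_wpM2l k0 kle; rewrite -E in h.
  have [y0|y0] := leP 0 y; rewrite ?(ger0_norm y0) ?(ltr0_norm y0) in h.
    by rewrite -[leLHS]addr0 lerD ?expR_ge0// ler_expR.
  by rewrite -[leLHS]add0r lerD ?expR_ge0// ler_expR mulNr -mulrN.
apply: (@le_trans _ _ (expR (sq_rate c * (k%:R + 1) ^+ 2 - k%:R ^+ 2 / (2 * c)) *
   expR (k%:R ^+ 2 / (2 * c)))); last by rewrite ler_wpM2l ?expR_ge0.
rewrite -expRD subrK ler_expR ler_wpM2l//.
  by rewrite invr_ge0 mulr_ge0// ltW.
rewrite -[leLHS]real_normK ?num_real// lerXn2r ?nnegrE ?addr_ge0//.
exact: ltW.
Qed.

Local Open Scope ereal_scope.

Lemma integral_cst_prob (r : R) : \int[P]_w r%:E = r%:E.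
Proof. by rewrite -[RHS](expectation_cst P r) unlock. Qed.

Lemma subg_sq_moment (c : R) (Y : Omega -> R) : (0 < c)%R -> measurable_fun setT Y ->
  (forall t : R, \int[P]_w (expR (t * Y w))%:E <= (expR (c * t ^+ 2))%:E) ->
  \int[P]_w (expR (sq_rate c * Y w ^+ 2))%:E <= (sq_moment c)%:E.
Proof.
move=> c0 mY sg.
pose A (k : nat) : R := expR (sq_rate c * (k%:R + 1) ^+ 2 - k%:R ^+ 2 / (2 * c)).
pose T (k : nat) w : R := (A k *
    (expR (k%:R / (2 * c) * Y w) + expR (- (k%:R / (2 * c)) * Y w)))%R.
have T0 k w : (0 <= T k w)%R by rewrite mulr_ge0 ?expR_ge0// addr_ge0 ?expR_ge0.
have me (t : R) : measurable_fun setT (fun w => expR (t * Y w)).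
  by apply: measurableT_comp => //; apply: measurable_funM => //.
have mT k : measurable_fun setT (T k).
  by apply: measurable_funM => //; apply: measurable_funD.
have mTE k : measurable_fun setT (fun w => (T k w)%:E) by exact/measurable_EFinP.
pose r : R := expR (- (8 * c)^-1).
have c8 : (0 < (8 * c)^-1)%R by rewrite invr_gt0 mulr_gt0.
have r0 : (0 < r)%R by exact: expR_gt0.
have r1 : (r < 1)%R by rewrite expR_lt1 oppr_lt0.
have intT k : \int[P]_w (T k w)%:E <= (geometric (2 * expR (8 * c)^-1) r k)%:E.
  under eq_integral do rewrite EFinM.
  rewrite ge0_integralZl//; first last.
  - by rewrite lee_fin expR_ge0.
  - by apply/measurable_EFinP; apply: measurable_funD.
  under eq_integral do rewrite EFinD.
  rewrite ge0_integralD//; first last.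
  - exact/measurable_EFinP.
  - exact/measurable_EFinP.
  apply: (@le_trans _ _ ((A k)%:E * (2 * expR (k%:R ^+ 2 / (4 * c)))%:E)).
    rewrite lee_wpmul2l ?lee_fin ?expR_ge0// (le_trans (leeD (sg _) (sg _)))//.
    rewrite -EFinD lee_fin sqrrN.
    have -> : (c * (k%:R / (2 * c)) ^+ 2 = k%:R ^+ 2 / (4 * c))%R by field; rewrite gt_eqF.
    lra.
  rewrite -EFinM lee_fin /geometric /= /r -expRM_natl mulrCA -[leRHS]mulrA ler_wpM2l//.
  rewrite /A -!expRD ler_expR /sq_rate.
  have c1 : (c != 0)%R by rewrite gt_eqF.
  (* The two exponents differ by [(3 k^2 - 4 k + 1) / (16 c)], nonnegative at every natural [k]
     though not at every real. *)
  have kk : (k%:R <= k%:R ^+ 2 :> R)%R by rewrite -natrX ler_nat; case: (k) => // n; rewrite expnS leq_pmulr// expn_gt0.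
  rewrite -subr_ge0.
  rewrite (_ : (_ - _)%R = (2 * (k%:R ^+ 2 - k%:R) + (k%:R - 1) ^+ 2) / (16 * c))%R; last by field.
  rewrite divr_ge0 ?mulr_ge0 ?(ltW c0)//.
  by have := sqr_ge0 (k%:R - 1 : R); lra.
apply: (@le_trans _ _ (\int[P]_w (\sum_(k <oo) (T k w)%:E))).
  apply: ge0_le_integral => //.
  - apply/measurable_EFinP; apply: measurableT_comp => //.
    by apply: measurable_funM => //; apply: measurable_funX.
  - by apply: ge0_emeasurable_sum => // k w _ _; rewrite lee_fin.
  move=> w _; pose k := Num.truncn `|Y w|.
  apply: (@le_trans _ _ (T k w)%:E); first by rewrite lee_fin expR_sqr_le_series.
  apply: le_trans (nneseries_lim_ge k.+1 _); last by move=> n _ _; rewrite lee_fin.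
  by rewrite big_nat_recr//= leeDr// sume_ge0// => n _; rewrite lee_fin.
rewrite integral_nneseries//; last by move=> n w _; rewrite lee_fin.
apply: le_trans (lee_nneseries _ (fun n _ => intT n)) _.
  by move=> n _ _; apply: integral_ge0 => w _; rewrite lee_fin.
have g0 n : (0 <= geometric (2 * expR (8 * c)^-1) r n)%R.
  by apply: geometric_ge0; [apply: mulr_ge0 => //; exact: expR_ge0|exact: ltW].
apply: lime_le; first by apply: is_cvg_nneseries => n _ _; rewrite lee_fin.
near=> n; rewrite sumEFin lee_fin.
apply: geometric_le_lim => //.
by rewrite ger0_norm ?expR_ge0.
Unshelve. all: by end_near. Qed.

(** With [a = sq_rate c], the factor [16 / a ^ 2] is [4 / b ^ 2] of [sqr_le_expR] at [b = a / 2],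
    and [expR a] pays for the shift from [y] to [y + 1]. *)
Definition sq_var (c : R) : R :=
  16 / sq_rate c ^+ 2 * expR (sq_rate c) * sq_moment c.

(** The linear Taylor term has mean zero. The remainder is absorbed by [exp (a Y^2)]: half of the
    rate [a] pays for the quadratic factor, the other half for the exponential one. *)
Lemma subg_centered_sq (c t tau : R) (Y : Omega -> R) : (0 < c)%R ->
  measurable_fun setT Y ->
  (forall t : R, \int[P]_w (expR (t * Y w))%:E <= (expR (c * t ^+ 2))%:E) ->
  \int[P]_w (Y w ^+ 2)%:E = tau%:E -> (0 <= tau <= 1)%R ->
  (`|t| <= sq_rate c / 2)%R ->
  \int[P]_w (expR (t * (Y w ^+ 2 - tau)))%:E <= (expR (sq_var c * t ^+ 2))%:E.
Proof.
move=> c0 mY sg EY /andP[tau0 tau1] ta.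
set a := sq_rate c in ta *.
have a0 : (0 < a)%R by rewrite invr_gt0 mulr_gt0.
pose D : R := (16 / a ^+ 2 * expR a)%R.
have D0 : (0 <= D)%R by rewrite mulr_ge0 ?expR_ge0// divr_ge0// exprn_ge0// ltW.
have mom := subg_sq_moment c0 mY sg; rewrite -/a in mom.
pose e w := expR (a * Y w ^+ 2).
have mY2 : measurable_fun setT (fun w => Y w ^+ 2)%R by exact: measurable_funX.
have me : measurable_fun setT e.
  by apply: measurableT_comp => //; apply: measurable_funM.
have ie : P.-integrable setT (EFin \o e).
  apply/integrableP; split; first exact/measurable_EFinP.
  under eq_integral do rewrite /= ger0_norm ?expR_ge0//.
  by rewrite (le_lt_trans mom)// ltry.
have iY2 : P.-integrable setT (EFin \o (fun w => Y w ^+ 2)%R).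
  apply/integrableP; split; first exact/measurable_EFinP.
  under eq_integral do rewrite /= ger0_norm ?sqr_ge0//.
  by rewrite EY ltry.
have ic (x : R) : P.-integrable setT (EFin \o (fun=> x)).
  exact: finite_measure_integrable_cst.
pose h w := ((1 - t * tau) + t * Y w ^+ 2 + t ^+ 2 * D * e w)%R.
have ih1 : P.-integrable setT (EFin \o (fun w => t * Y w ^+ 2)%R).
  exact: (integrableZl measurableT t iY2).
have ih2 : P.-integrable setT (EFin \o (fun w => t ^+ 2 * D * e w)%R).
  exact: (integrableZl measurableT (t ^+ 2 * D) ie).
have ih3 : P.-integrable setT (EFin \o (fun w => (1 - t * tau) + t * Y w ^+ 2)%R).
  exact: (integrableD measurableT (ic _) ih1).
have ih : P.-integrable setT (EFin \o h) by exact: (integrableD measurableT ih3 ih2).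
have pt w : (expR (t * (Y w ^+ 2 - tau)) <= h w)%R.
  apply: le_trans (expR_le_taylor1 _) _.
  have y0 := sqr_ge0 (Y w); set y := (Y w ^+ 2)%R in y0 *.
  have nu : (`|t * (y - tau)| <= a / 2 * (y + 1))%R.
    by rewrite normrM ler_pM// ler_norml; apply/andP; split; lra.
  have b0 : (0 < a / 2)%R by rewrite divr_gt0.
  have y1 : (0 <= y + 1)%R by rewrite addr_ge0.
  have q1 := sqr_le_expR b0 y1.
  have q2 : ((y - tau) ^+ 2 <= (y + 1) ^+ 2)%R.
    rewrite -[leLHS]real_normK ?num_real// lerXn2r ?nnegrE// ler_norml.
    by apply/andP; split; lra.
  have q3 : (expR `|t * (y - tau)| <= expR (a / 2 * (y + 1)))%R by rewrite ler_expR.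
  have q4 : (e w * expR a = expR (a / 2 * (y + 1)) * expR (a / 2 * (y + 1)))%R.
    by rewrite /e -/y -!expRD; congr expR; field.
  have q5 : ((y - tau) ^+ 2 * expR `|t * (y - tau)| <= D * e w)%R.
    apply: (@le_trans _ _ (4 / (a / 2) ^+ 2 * expR (a / 2 * (y + 1)) * expR (a / 2 * (y + 1)))%R).
      by rewrite ler_pM ?sqr_ge0 ?expR_ge0// (le_trans q2).
    rewrite -mulrA -q4 /D le_eqVlt; apply/orP; left; apply/eqP.
    by field; rewrite gt_eqF.
  rewrite /h -/y exprMn -[(t ^+ 2 * D * _)%R]mulrA -[(t ^+ 2 * _ * expR _)%R]mulrA.
  have := ler_wpM2l (sqr_ge0 t) q5.
  move: (t ^+ 2 * (_ * expR _))%R (t ^+ 2 * (D * _))%R => Z1 Z2; lra.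
have mh : measurable_fun setT (EFin \o h) by exact: measurable_int ih.
apply: (@le_trans _ _ (\int[P]_w (h w)%:E)).
  apply: ge0_le_integral => //.
  - apply/measurable_EFinP; apply: measurableT_comp => //.
    by apply: measurable_funM => //; apply: measurable_funB.
  - by move=> w _; rewrite lee_fin.
rewrite (integralD_EFin measurableT ih3 ih2) (integralD_EFin measurableT (ic _) ih1).
rewrite (integralZl measurableT iY2) (integralZl measurableT ie) EY.
rewrite /= integral_cst_prob -EFinM -EFinD.
rewrite addrNK.
have D1 : (0 <= t ^+ 2 * D)%R by rewrite mulr_ge0 ?sqr_ge0.
apply: (@le_trans _ _ (1%:E + (t ^+ 2 * D)%:E * (sq_moment c)%:E)).
  by rewrite leeD2l// lee_wpmul2l ?lee_fin.
rewrite -EFinM -EFinD lee_fin (le_trans (expR_ge1Dx _))// ler_expR.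
by rewrite /sq_var -/a -/D [leRHS](_ : _ = t ^+ 2 * D * sq_moment c)%R//; ring.
Qed.

(** A vanishing expectation does not by itself give integrability; it is drawn from the finite
    second moment through [|X| <= 1 + X^2]. *)
Lemma centered_second_moment (X : {RV P >-> R}) : 'E_P[X] = 0 -> 'V_P[X] = 1 ->
  P.-integrable setT (EFin \o X) /\ \int[P]_w (X w ^+ 2)%:E = 1.
Proof.
move=> E0 V1.
have S : \int[P]_w (X w ^+ 2)%:E = 1.
  rewrite -V1 /variance unlock E0 /= unlock; apply: eq_integral => w _ /=.
  by rewrite !fctE /= oppr0 addr0 expr2.
split => //; apply/integrableP; split; first exact/measurable_EFinP.
have mX2 : measurable_fun setT (fun w => X w ^+ 2)%R by exact: measurable_funX.
apply: (@le_lt_trans _ _ (\int[P]_w (1 + X w ^+ 2)%:E)).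
  apply: ge0_le_integral => //.
  - by apply: measurableT_comp => //; exact/measurable_EFinP.
  - by apply/measurable_EFinP; apply: measurable_funD.
  - move=> w _; rewrite /= lee_fin -[(X w ^+ 2)%R]real_normK ?num_real//.
    by have := sqr_ge0 (`|X w| - 1/2)%R; rewrite sqrrB; lra.
under eq_integral do rewrite EFinD.
rewrite ge0_integralD//; first last.
- exact/measurable_EFinP.
- by move=> w _; rewrite lee_fin sqr_ge0.
by rewrite S integral_cst_prob -EFinD ltry.
Qed.

End Moments.

(** * Tail bounds for a fixed set of measurements and a fixed vector *)

Lemma measurable_norm_gt {R : realType} (d : measure_display) (T : measurableType d)
  (f : T -> R) (x : R) : measurable_fun setT f -> measurable [set w | x < `|f w|].
Proof.
move=> mf; have mn : measurable_fun setT (fun w => `|f w|) by exact: measurableT_comp.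
have := mn measurableT `]x, +oo[ (measurable_itv _); rewrite setTI.
by congr measurable; apply/seteqP; split => w /=; rewrite in_itv /= andbT.
Qed.

Lemma measurable_norm_le {R : realType} (d : measure_display) (T : measurableType d)
  (f : T -> R) (x : R) : measurable_fun setT f -> measurable [set w | `|f w| <= x].
Proof.
move=> mf; rewrite [X in measurable X](_ : _ = ~` [set w | x < `|f w|]).
  by apply: measurableC; exact: measurable_norm_gt.
by apply/seteqP; split => w /=; rewrite leNgt => /negP.
Qed.

Section Tails.
Context {R : realType} {d : measure_display} {Omega : measurableType d}.
Variable P : probability Omega R.
Local Open Scope ereal_scope.

Lemma lee_prod_EFin (T : Type) (r : seq T) (f : T -> \bar R) (g : T -> R) :
  (forall i, 0 <= f i) -> (forall i, f i <= (g i)%:E) ->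
  \prod_(i <- r) f i <= (\prod_(i <- r) g i)%:E.
Proof.
move=> f0 fg; elim: r => [|a r IH]; first by rewrite !big_nil.
rewrite !big_cons EFinM lee_pmul//.
by elim/big_ind: _ => // *; exact: mule_ge0.
Qed.

Lemma probability_le_integral (E : set Omega) (f : Omega -> R) : measurable E ->
  measurable_fun setT f -> (forall w, 0 <= f w)%R -> (forall w, E w -> 1 <= f w)%R ->
  P E <= \int[P]_w (f w)%:E.
Proof.
move=> mE mf f0 f1; rewrite -[E]setIT -integral_indic//.
apply: ge0_le_integral => //.
- by apply/measurable_EFinP; exact: measurable_indic.
- exact/measurable_EFinP.
move=> w _; rewrite lee_fin indicE; case: (boolP (w \in E)) => [|_]; last exact: f0.
by rewrite inE => /f1.
Qed.

Lemma probability_finite_union (T : finType) (Q : pred T) (F : set Omega)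
    (E : T -> set Omega) : measurable F -> (forall i, measurable (E i)) ->
  (forall w, F w -> exists2 i, Q i & E i w) -> P F <= \sum_(i | Q i) P (E i).
Proof.
move=> mF mE sub.
have mU (r : seq T) : measurable (\big[setU/set0]_(i <- r | Q i) E i).
  by apply: bigsetU_measurable.
have FU : F `<=` \big[setU/set0]_(i | Q i) E i.
  by move=> w /sub[i Qi Ei]; rewrite -bigcup_pred; exists i.
rewrite (le_trans (le_measure _ _ _ FU)) ?inE//.
elim: (index_enum T) => [|i r IH]; first by rewrite !big_nil measure0.
rewrite !big_cons; case: ifP => // Qi.
by rewrite (le_trans (measureU2 P (mE i) (mU r)))// leeD2l.
Qed.

Section Rows.
Context {m N : nat}.
Variables (A : 'I_m -> 'I_N -> {RV P >-> R}) (L : 'I_m -> {RV P >-> R}).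

(** One family for entries and links, so that independence of matrix and network is disjointness of
    [all_entries] and [all_links]. *)
Definition entries_links (k : ('I_m * 'I_N) + 'I_m) : {RV P >-> R} :=
  match k with inl ij => A ij.1 ij.2 | inr i => L i end.

Local Notation X := entries_links.
Local Notation index := (('I_m * 'I_N) + 'I_m)%type.

Definition entry_row (i : 'I_m) : {set index} :=
  [set k : index | if k is inl ij then ij.1 == i else false]%SET.

Definition all_entries : {set index} :=
  [set k : index | if k is inl ij then true else false]%SET.

Definition all_links : {set index} :=
  [set k : index | if k is inl ij then false else true]%SET.

Definition projection (v : 'cV[R]_N) (i : 'I_m) (w : Omega) : R :=
  (\sum_j A i j w * v j 0)%R.

Lemma projection_block v i :
  measurable_fun [set: block X (entry_row i)] (projection v i : block X (entry_row i) -> R).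
Proof.
apply: measurable_sum => j; apply: measurable_funM => //.
by apply: (@block_RV _ _ _ _ _ X _ (inl (i, j))); rewrite inE.
Qed.

Lemma projection_measurable v i : measurable_fun setT (projection v i).
Proof. exact: (@block_fun_measurable _ _ _ P _ X (entry_row i) _ (@projection_block v i)). Qed.

Lemma entry_row_disjoint i i' : i != i' -> [disjoint entry_row i & entry_row i']%B.
Proof.
move=> ne; apply/pred0P => -[[k j]|k]; rewrite /= !inE //=.
by apply/negP => /andP[/eqP -> /eqP e]; rewrite e eqxx in ne.
Qed.

Hypothesis ind : mutually_independent X.
Variable c : R.
Hypothesis c0 : (0 < c)%R.
Hypothesis hA : forall i j, 'E_P[A i j] = 0 /\ 'V_P[A i j] = 1 /\ subGaussian (A i j) c.

Lemma singleton_disjoint (a b : index) : a != b -> [disjoint [set a]%SET & [set b]%SET]%B.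
Proof.
by move=> ab; apply/pred0P => k; rewrite /= !inE; apply/negP => /andP[/eqP -> /eqP e]; rewrite e eqxx in ab.
Qed.

(** The moment generating function factorises over the row, and the exponents [c (t v_j)^2] add up
    to [c t^2 |v|^2]. *)
Lemma projection_subg v i (t : R) : (sqnorm v <= 1)%R ->
  \int[P]_w (expR (t * projection v i w))%:E <= (expR (c * t ^+ 2))%:E.
Proof.
move=> v1.
have E w : expR (t * projection v i w) = (\prod_j expR (t * v j 0 * A i j w))%R.
  by rewrite /projection mulr_sumr expR_sum; apply: eq_bigr => j _; congr expR; ring.
under eq_integral do rewrite E.
rewrite (@ge0_integral_block_prod _ _ _ _ _ X ind _ _ (fun j => [set inl (i, j)]%SET)
  (fun j w => expR (t * v j 0 * A i j w)%R))//; first last.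
- move=> j _; apply: measurableT_comp => //; apply: measurable_funM => //.
  by apply: (@block_RV _ _ _ _ _ X _ (inl (i, j))); rewrite inE.
- move=> j k _ _ jk; apply: singleton_disjoint.
  by apply: contra jk => /eqP[->].
- exact: index_enum_uniq.
apply: le_trans (lee_prod_EFin (g := fun j => expR (c * (t * v j 0) ^+ 2)%R) _ _ _) _.
- by move=> j; apply: integral_ge0 => w _; rewrite lee_fin expR_ge0.
- by move=> j; have [_ [_ sg]] := hA i j; exact: sg.
rewrite lee_fin -expR_sum ler_expR -mulr_sumr ler_wpM2l ?(ltW c0)//.
under eq_bigr do rewrite exprMn.
by rewrite -mulr_sumr ler_piMr// sqr_ge0.
Qed.

Lemma entry_covariance i j k : P.-integrable setT (EFin \o (A i j \* A i k)%R) /\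
  \int[P]_w (A i j w * A i k w)%:E = (j == k)%:R%:E.
Proof.
have [E1 [V1 _]] := hA i j; have [i1 s1] := centered_second_moment E1 V1.
have [E2 [V2 _]] := hA i k; have [i2 s2] := centered_second_moment E2 V2.
have [<-|jk] := eqVneq j k.
  split => //; apply/integrableP; split.
    by apply/measurable_EFinP; apply: measurable_funM.
  rewrite (_ : \int[P]_w _ = 1) ?ltry// -s1; apply: eq_integral => w _ /=.
  by rewrite ger0_norm -expr2// sqr_ge0.
have [|fi ->] := integral_indepM i1 i2.
  apply: (@block_indep_fun _ _ _ _ _ X ind [set inl (i, j)]%SET [set inl (i, k)]%SET).
  - by apply: singleton_disjoint; apply: contra jk => /eqP[->].
  - by apply: (@block_RV _ _ _ _ _ X _ (inl (i, j))); rewrite inE.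
  - by apply: (@block_RV _ _ _ _ _ X _ (inl (i, k))); rewrite inE.
split => //; move: E1; rewrite unlock => ->.
by rewrite mul0e.
Qed.

Lemma projection_second_moment v i : \int[P]_w (projection v i w ^+ 2)%:E = (sqnorm v)%:E.
Proof.
have E w : (projection v i w ^+ 2)%:E =
    \sum_(jk : 'I_N * 'I_N) ((v jk.1 0 * v jk.2 0)%:E * (A i jk.1 w * A i jk.2 w)%:E).
  under eq_bigr do rewrite -EFinM.
  rewrite sumEFin; congr EFin.
  rewrite -(pair_bigA _ (fun j k => v j 0 * v k 0 * (A i j w * A i k w)))%R /=.
  rewrite expr2 /projection mulr_suml; apply: eq_bigr => j _.
  by rewrite mulr_sumr; apply: eq_bigr => k _; ring.
under eq_integral do rewrite E.
have int jk : P.-integrable setT (fun w => (v jk.1 0 * v jk.2 0)%:E * (A i jk.1 w * A i jk.2 w)%:E).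
  by apply: integrableZl => //; have [] := entry_covariance i jk.1 jk.2.
rewrite integral_sum//.
under eq_bigr => jk _.
  rewrite integralZl//; last by have [] := entry_covariance i jk.1 jk.2.
  have [_ ->] := entry_covariance i jk.1 jk.2.
  rewrite -EFinM; over.
rewrite sumEFin; congr EFin.
rewrite -(pair_bigA _ (fun j k => v j 0 * v k 0 * (j == k)%:R))%R /=.
apply: eq_bigr => j _; rewrite (bigD1 j)//= big1 ?addr0; last first.
  by move=> k /negPf; rewrite eq_sym => ->; rewrite mulr0.
by rewrite eqxx mulr1 expr2.
Qed.

(** For nonempty [T], this is [#|T|] times the defect of the normalised sample; leaving out the
    division makes it a plain sum over independent rows. *)
Definition centered_energy (T : {set 'I_m}) v w : R :=
  (\sum_(i in T) (projection v i w ^+ 2 - sqnorm v))%R.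

Lemma centered_energy_block (T : {set 'I_m}) (v : 'cV[R]_N) :
  measurable_fun [set: block X all_entries] (centered_energy T v : block X all_entries -> R).
Proof.
rewrite /centered_energy; under eq_fun do rewrite big_mkcond.
apply: measurable_sum => i; case: (i \in T) => //.
apply: measurable_funB => //; apply: measurable_funX.
apply: block_fun_sub (@projection_block v i).
by apply/fintype.subsetP => -[[k j]|k]; rewrite !inE.
Qed.

Lemma centered_energy_measurable (T : {set 'I_m}) (v : 'cV[R]_N) : measurable_fun setT (centered_energy T v).
Proof. exact: (@block_fun_measurable _ _ _ P _ X all_entries _ (@centered_energy_block T v)). Qed.

Lemma centered_energy_mgf (T : {set 'I_m}) (v : 'cV[R]_N) (t : R) : (sqnorm v <= 1)%R -> (`|t| <= sq_rate c / 2)%R ->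
  \int[P]_w (expR (t * centered_energy T v w))%:E <= (expR (#|T|%:R * (sq_var c * t ^+ 2)))%:E.
Proof.
move=> v1 ta.
have E w : expR (t * centered_energy T v w) =
    (\prod_(i <- enum T) expR (t * (projection v i w ^+ 2 - sqnorm v)))%R.
  by rewrite /centered_energy mulr_sumr expR_sum big_enum.
under eq_integral do rewrite E.
rewrite (@ge0_integral_block_prod _ _ _ _ _ X ind _ _ entry_row
  (fun i w => expR (t * (projection v i w ^+ 2 - sqnorm v))%R))//; first last.
- move=> i _; apply: measurableT_comp => //; apply: measurable_funM => //.
  by apply: measurable_funB => //; apply: measurable_funX; exact: projection_block.
- by move=> i k _ _; exact: entry_row_disjoint.
- exact: enum_uniq.
apply: le_trans (lee_prod_EFin (g := fun=> expR (sq_var c * t ^+ 2)%R) _ _ _) _.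
- by move=> j; apply: integral_ge0 => w _; rewrite lee_fin expR_ge0.
- move=> i; apply: subg_centered_sq => //.
  + exact: projection_measurable.
  + by move=> u; exact: projection_subg.
  + exact: projection_second_moment.
  + by rewrite sqnorm_ge0.
by rewrite lee_fin big_enum /= prodr_const -expRM_natl.
Qed.

Lemma sq_moment_ge2 : (2 <= sq_moment c)%R.
Proof.
have c8 : (0 < (8 * c)^-1)%R by rewrite invr_gt0 mulr_gt0.
have r0 := expR_gt0 (- (8 * c)^-1); have r1 : (expR (- (8 * c)^-1) < 1)%R.
  by rewrite expR_lt1 oppr_lt0.
rewrite /sq_moment ler_pdivlMr; last by lra.
have := expR_ge1Dx ((8 * c)^-1); lra.
Qed.

Lemma sq_rate_gt0 : (0 < sq_rate c)%R.
Proof. by rewrite invr_gt0 mulr_gt0. Qed.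

(** Guarantees that the optimal Chernoff parameter [eta / (2 * sq_var c)] stays below
    [sq_rate c / 2] for every [eta <= 1]. *)
Lemma sq_var_ge : ((sq_rate c)^-1 <= sq_var c)%R.
Proof.
have a0 := sq_rate_gt0; rewrite /sq_var.
have h1 : (sq_rate c * 2 <= expR (sq_rate c) * sq_moment c)%R.
  rewrite ler_pM ?sq_moment_ge2 ?(ltW a0)//.
  by have := expR_ge1Dx (sq_rate c); lra.
rewrite -mulrA.
have -> : ((sq_rate c)^-1 = (sq_rate c) / (sq_rate c) ^+ 2)%R by field; rewrite gt_eqF.
rewrite mulrC -[leRHS]mulrA mulrCA ler_wpM2l ?invr_ge0 ?exprn_ge0 ?(ltW a0)//.
lra.
Qed.

Lemma sq_var_gt0 : (0 < sq_var c)%R.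
Proof. by apply: lt_le_trans sq_var_ge; rewrite invr_gt0 sq_rate_gt0. Qed.

Lemma centered_energy_tail (T : {set 'I_m}) (v : 'cV[R]_N) (eta : R) : (sqnorm v <= 1)%R -> (0 < eta <= 1)%R ->
  P [set w | `|centered_energy T v w| > #|T|%:R * eta]%R <=
  (2 * expR (- (eta ^+ 2 / (4 * sq_var c) * #|T|%:R)))%:E.
Proof.
move=> v1 /andP[e0 e1].
have M0 := sq_var_gt0; have a0 := sq_rate_gt0.
(* Minimiser of [sq_var c * t^2 - t * eta], with minimum [- eta^2 / (4 * sq_var c)]. *)
pose t := (eta / (2 * sq_var c))%R.
have t0 : (0 < t)%R by apply: divr_gt0 => //; apply: mulr_gt0.
have ta : (`|t| <= sq_rate c / 2)%R.
  rewrite gtr0_norm// /t ler_pdivrMr; last by apply: mulr_gt0.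
  have h : (1 <= sq_rate c * sq_var c)%R.
    by rewrite -ler_pdivrMl// mulr1 sq_var_ge.
  lra.
set n : R := #|T|%:R.
have mZ := @centered_energy_measurable T v.
pose f (u : R) w := (expR (- (t * (n * eta))) * expR (u * centered_energy T v w))%R.
have mf u : measurable_fun setT (f u).
  apply: measurable_funM => //; apply: measurableT_comp => //.
  by apply: measurable_funM.
have bf (u : R) : `|u|%R = t ->
    \int[P]_w (f u w)%:E <= (expR (- (eta ^+ 2 / (4 * sq_var c) * n)))%:E.
  move=> ut; rewrite /f; under eq_integral do rewrite EFinM.
  have mu : measurable_fun setT (fun w => (expR (u * centered_energy T v w))%:E).
    by apply/measurable_EFinP; apply: measurableT_comp => //; apply: measurable_funM.
  rewrite ge0_integralZl ?lee_fin ?expR_ge0//.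
  apply: (@le_trans _ _ ((expR (- (t * (n * eta))))%:E * (expR (n * (sq_var c * u ^+ 2)))%:E)).
    rewrite lee_wpmul2l ?lee_fin ?expR_ge0// centered_energy_mgf//.
    by rewrite ut; move: ta; rewrite gtr0_norm.
  rewrite -EFinM lee_fin -expRD ler_expR -[(u ^+ 2)%R]real_normK ?num_real// ut /t.
  rewrite le_eqVlt; apply/orP; left; apply/eqP; field.
  by rewrite gt_eqF.
have mE : measurable [set w | `|centered_energy T v w| > n * eta]%R.
  exact: measurable_norm_gt.
(* The parameters [t] and [- t] treat the two signs of the deviation; hence the factor [2]. *)
apply: (@le_trans _ _ (\int[P]_w (f t w + f (- t) w)%:E)).
  apply: probability_le_integral => //.
  - exact: measurable_funD.
  - by move=> w; rewrite addr_ge0// mulr_ge0 ?expR_ge0.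
  move=> w /=; rewrite /f -!expRD ltr_normr => /orP[h|h].
  - rewrite -[leLHS]addr0 lerD ?expR_ge0// -[leLHS]expR0 ler_expR.
    by have := ler_wpM2l (ltW t0) (ltW h); lra.
  - rewrite -[leLHS]add0r lerD ?expR_ge0// -[leLHS]expR0 ler_expR.
    by have := ler_wpM2l (ltW t0) (ltW h); lra.
under eq_integral do rewrite EFinD.
rewrite ge0_integralD//; first last.
- exact/measurable_EFinP.
- by move=> w _; rewrite lee_fin mulr_ge0 ?expR_ge0.
- exact/measurable_EFinP.
- by move=> w _; rewrite lee_fin mulr_ge0 ?expR_ge0.
rewrite mulr2n mulrDl mul1r EFinD leeD//; apply: bf; rewrite ?normrN gtr0_norm//.
Qed.

Definition sample (T : {set 'I_m}) (w : Omega) : 'M[R]_(#|T|, N) :=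
  normalized_sub T (\matrix_(i, j) A i j w).

Lemma defect_sample (T : {set 'I_m}) (v : 'cV[R]_N) w : (0 < #|T|)%N ->
  defect (sample T w) v = (#|T|%:R^-1 * centered_energy T v w)%R.
Proof.
move=> T0; have n0 : (#|T|%:R != 0 :> R)%R by rewrite pnatr_eq0 -lt0n.
rewrite /defect /sample /normalized_sub -scalemxAl sqnormZ exprVn sqr_sqrtr//.
rewrite /centered_energy sumrB sumr_const mulrBr -[X in (_ - _ * X)%R]mulr_natl mulrA mulVf// mul1r.
congr (_ * _ - _)%R; rewrite /sqnorm (big_enum_val (fun i => projection v i w ^+ 2))%R /=.
apply: eq_bigr => i _; congr (_ ^+ 2)%R; rewrite mxE; apply: eq_bigr => j _.
by rewrite !mxE.
Qed.

Lemma defect_sample0 (T : {set 'I_m}) (v : 'cV[R]_N) w : (#|T| = 0)%N -> defect (sample T w) v = (- sqnorm v)%R.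
Proof.
move=> T0; rewrite /defect [sqnorm (_ *m _)](_ : _ = 0)%R ?sub0r//.
rewrite /sqnorm big1// => i _; exfalso; move: i; rewrite T0 => -[]//.
Qed.

Lemma defect_sample_block (T : {set 'I_m}) (v : 'cV[R]_N) : measurable_fun [set: block X all_entries]
  ((fun w => defect (sample T w) v) : block X all_entries -> R).
Proof.
have [T0|T0] := posnP #|T|.
  by under eq_fun do rewrite (defect_sample0 _ _ T0); exact: measurable_cst.
under eq_fun do rewrite (defect_sample _ _ T0).
by apply: measurable_funM => //; exact: centered_energy_block.
Qed.

Lemma defect_sample_tail (T : {set 'I_m}) (v : 'cV[R]_N) (eta : R) : (sqnorm v <= 1)%R -> (0 < eta <= 1)%R ->
  P [set w | `|defect (sample T w) v| > eta]%R <=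
  (2 * expR (- (eta ^+ 2 / (4 * sq_var c) * #|T|%:R)))%:E.
Proof.
move=> v1 e01; have [T0|T0] := posnP #|T|.
  (* When nothing is received the claimed bound is [2], more than any probability. *)
  rewrite [leRHS](_ : _ = 2%:E); last by rewrite T0 mulr0 oppr0 expR0 mulr1.
  rewrite (@le_trans _ _ 1)//; last by rewrite lee_fin ler1n.
  apply: probability_le1; apply: (@block_measurable _ _ _ _ _ X all_entries).
  apply: (@measurable_norm_gt _ _ (block X all_entries)).
  exact: (@defect_sample_block T v).
apply: le_trans (centered_energy_tail T v1 e01).
rewrite le_eqVlt; apply/orP; left; apply/eqP; congr (P _).
apply/seteqP; split => w /=; rewrite (defect_sample _ _ T0) normrM ger0_norm ?invr_ge0//;
  by rewrite ltr_pdivlMl// ltr0n.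
Qed.

End Rows.
End Tails.

(** * Generating function of the number of received measurements *)

Section Network.
Context {R : realType}.
Implicit Types p y : R.

Definition link_weight p (b : bool) : R := if b then p else 1 - p.

(** The true values occupy a final segment of length [M], on which the powers add up to
    [1 + y + ... + y^(M-1)]; the identity is this geometric sum. *)
Lemma expr_count_monotone y K (a : nat -> bool) :
  (forall j, (j.+1 < K)%N -> a j -> a j.+1) ->
  y ^+ (\sum_(j < K) a j) = 1 - (1 - y) * \sum_(j < K) y ^+ (K - j.+1) * (a j)%:R.
Proof.
elim: K a => [|K IH] a mono; first by rewrite !big_ord0 mulr0 subr0.
have monoS j : (j.+1 < K)%N -> a j.+1 -> a j.+2 by move=> jK; apply: mono.
rewrite !big_ord_recl /= subSS subn0.
have {}IH := IH (fun j => a j.+1) monoS.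
rewrite (eq_bigr (fun j : 'I_K => y ^+ (K - j.+1) * (a j.+1)%:R)); last first.
  by move=> j _; rewrite /bump /= add1n subSS.
rewrite (eq_bigr (fun j : 'I_K => a j.+1 : nat)); last by move=> j _; rewrite /bump /= add1n.
have [a0|a0] := boolP (a 0%N); last first.
  by rewrite /= add0n mulr0 add0r IH.
have all1 j : (j < K.+1)%N -> a j by elim: j => // j IHj jK; apply: mono => //; apply: IHj; exact: ltnW.
have E : (\sum_(j < K) (a j.+1 : nat) = K)%N.
  by rewrite (eq_bigr (fun=> 1%N)) ?sum1_card ?card_ord// => j _; rewrite all1// ltnS.
by rewrite /= mulr1 mulrDr opprD addrCA -IH E exprD; ring.
Qed.

Definition branch_alive K (h : {ffun 'I_K -> bool}) (j : nat) : bool :=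
  [forall j' : 'I_K, (j <= j')%N ==> h j'].

Definition branch_received K (h : {ffun 'I_K -> bool}) : nat :=
  (\sum_(j < K) branch_alive h j)%N.

(** Survival probability of sensor [j], counted from zero: its [K - j] onward links each contribute
    [p], while the earlier ones sum to [1]. *)
Lemma sum_branch_alive p K (j : 'I_K) :
  \sum_(h : {ffun 'I_K -> bool}) (\prod_i link_weight p (h i)) * (branch_alive h j)%:R =
  p ^+ (K - j).
Proof.
have E (h : {ffun 'I_K -> bool}) : (\prod_i link_weight p (h i)) * (branch_alive h j)%:R =
    \prod_i (link_weight p (h i) * ((j <= i)%N ==> h i)%:R).
  rewrite big_split /=; congr (_ * _).
  have [/forallP H|/forallPn[i ni]] := boolP (branch_alive h j).
    by rewrite big1// => i _; rewrite (H i).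
  by rewrite (bigD1 i)//= (negPf ni) mul0r.
under eq_bigr do rewrite E.
rewrite -(bigA_distr_bigA (fun (i : 'I_K) b => link_weight p b * ((j <= i)%N ==> b)%:R)) /=.
rewrite (eq_bigr (fun i : 'I_K => if (j <= i)%N then p else 1)); last first.
  move=> i _; rewrite big_bool /=; case: (j <= i)%N => /=; rewrite ?mulr1 ?mulr0 ?addr0//.
  by rewrite addrCA subrr addr0.
rewrite -big_mkcond prodr_const; congr (_ ^+ _).
have -> : #|[pred i : 'I_K | (j <= i)%N]| = (\sum_(i < K) (j <= i)%N)%N.
  by rewrite -sum1_card big_mkcond.
rewrite -(big_mkord xpredT (fun i => (j <= i)%N : nat)) (big_cat_nat _ _ (n := j))//=; last exact: ltnW.
rewrite big_nat_cond big1 ?add0n; last by move=> i /andP[/andP[_ h] _]; rewrite leqNgt h.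
rewrite big_nat_cond (eq_bigr (fun=> 1%N)); last by move=> i /andP[/andP[-> _] _].
by rewrite -big_nat_cond sum_nat_const_nat muln1.
Qed.

Lemma branch_generating_function p y K : p * y != 1 ->
  \sum_(h : {ffun 'I_K -> bool}) (\prod_i link_weight p (h i)) * y ^+ branch_received h =
  (1 - p + p * (1 - y) * (p * y) ^+ K) / (1 - p * y).
Proof.
move=> py; have py0 : 1 - p * y != 0 by rewrite subr_eq0 eq_sym.
have E (h : {ffun 'I_K -> bool}) : y ^+ branch_received h =
    1 - (1 - y) * \sum_(j < K) y ^+ (K - j.+1) * (branch_alive h j)%:R.
  apply: expr_count_monotone => j _ /forallP H; apply/forallP => i.
  by apply/implyP => ji; have := H i; rewrite (ltnW ji).
under eq_bigr do rewrite E mulrBr mulr1 mulrCA mulr_sumr.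
rewrite sumrB -mulr_sumr exchange_big /=.
rewrite -(bigA_distr_bigA (fun (_ : 'I_K) b => link_weight p b)) /= big1; last first.
  by move=> i _; rewrite big_bool /= addrCA subrr addr0.
under eq_bigr => j _.
  under eq_bigr do rewrite mulrCA.
  rewrite -mulr_sumr sum_branch_alive.
  over.
(* Reversal turns [y^(K-j-1) p^(K-j)] into [p (p y)^j], the terms of a geometric sum. *)
rewrite (reindex_inj rev_ord_inj) /=.
rewrite (eq_bigr (fun j : 'I_K => p * (p * y) ^+ j)); last first.
  move=> j _; have jK := ltn_ord j.
  have -> : (K - (K - j.+1).+1 = j)%N by lia.
  have -> : (K - (K - j.+1) = j.+1)%N by lia.
  by rewrite exprMn exprS; ring.
rewrite -mulr_sumr.
have G : (1 - p * y) * \sum_(j < K) (p * y) ^+ j = 1 - (p * y) ^+ K.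
  by rewrite -opprB mulNr -subrX1 opprB.
apply: (mulfI py0); rewrite mulrBr mulr1 mulrCA (mulrCA _ p) G.
by field.
Qed.

Section Branches.
Context {nb K : nat}.

Definition received_links (f : {ffun 'I_(nb * K) -> bool}) : {set 'I_(nb * K)} :=
  [set i : 'I_(nb * K) | [forall i' : 'I_(nb * K),
      ((i' %/ K == i %/ K)%N && (i <= i')%N) ==> f i']]%SET.

Lemma sensor_index_proof (b : 'I_nb) (j : 'I_K) : (b * K + j < nb * K)%N.
Proof. by have := ltn_ord b; have := ltn_ord j; nia. Qed.

Definition sensor_index (bj : 'I_nb * 'I_K) : 'I_(nb * K) :=
  Ordinal (sensor_index_proof bj.1 bj.2).

Hypothesis K0 : (0 < K)%N.

Lemma sensor_branch_proof (i : 'I_(nb * K)) : (i %/ K < nb)%N.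
Proof. by rewrite ltn_divLR. Qed.

Lemma sensor_rank_proof (i : 'I_(nb * K)) : (i %% K < K)%N.
Proof. by rewrite ltn_mod. Qed.

Definition sensor_coords (i : 'I_(nb * K)) : 'I_nb * 'I_K :=
  (Ordinal (sensor_branch_proof i), Ordinal (sensor_rank_proof i)).

Lemma sensor_indexK : cancel sensor_index sensor_coords.
Proof.
case=> b j; congr pair; apply: val_inj => /=.
  by rewrite divnMDl// divn_small ?addn0.
by rewrite modnMDl modn_small.
Qed.

Lemma sensor_coordsK : cancel sensor_coords sensor_index.
Proof. by move=> i; apply: val_inj => /=; rewrite -divn_eq. Qed.

Definition join_branches (t : {ffun 'I_nb -> {ffun 'I_K -> bool}}) : {ffun 'I_(nb * K) -> bool} :=
  [ffun i => t (sensor_coords i).1 (sensor_coords i).2].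

Lemma join_branches_bij : bijective join_branches.
Proof.
exists (fun f : {ffun 'I_(nb * K) -> bool} => [ffun b => [ffun j => f (sensor_index (b, j))]]).
- move=> t; apply/ffunP => b; apply/ffunP => j; rewrite !ffunE.
  by rewrite sensor_indexK.
- by move=> f; apply/ffunP => i; rewrite !ffunE -surjective_pairing sensor_coordsK.
Qed.

(** Flat indices of the same branch compare as their ranks, so the condition on later links is a
    condition inside one branch. *)
Lemma card_received_join t :
  #|received_links (join_branches t)| = (\sum_b branch_received (t b))%N.
Proof.
rewrite -sum1_card big_mkcond /= (reindex sensor_index) /=; last first.
  by exists sensor_coords => i _; [exact: sensor_indexK|exact: sensor_coordsK].
rewrite -(pair_bigA _ (fun b j => if sensor_index (b, j) \in received_links (join_branches t)
  then 1 else 0)%N) /=.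
apply: eq_bigr => b _; apply: eq_bigr => j _.
rewrite inE; suff -> : [forall i' : 'I_(nb * K),
    ((i' %/ K == sensor_index (b, j) %/ K)%N && (sensor_index (b, j) <= i')%N)
      ==> join_branches t i'] = branch_alive (t b) j by case: branch_alive.
have db : ((b * K + j) %/ K = b)%N by rewrite divnMDl// divn_small ?addn0.
apply/forallP/forallP => H.
- move=> j'; apply/implyP => jj'; have := H (sensor_index (b, j')).
  rewrite ffunE sensor_indexK /= db divnMDl// divn_small// addn0 eqxx /= leq_add2l jj'.
  by [].
- move=> i'; rewrite -(sensor_coordsK i'); move: (sensor_coords i') => [b' j'].
  rewrite ffunE sensor_indexK /= db divnMDl// divn_small// addn0.
  apply/implyP => /andP[/eqP/val_inj -> le]; have := H j'.
  by rewrite leq_add2l in le; rewrite le.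
Qed.

Lemma network_generating_function p y : p * y != 1 ->
  \sum_(f : {ffun 'I_(nb * K) -> bool})
    (\prod_i link_weight p (f i)) * y ^+ #|received_links f| =
  ((1 - p + p * (1 - y) * (p * y) ^+ K) / (1 - p * y)) ^+ nb.
Proof.
move=> py; rewrite (reindex join_branches) /=; last exact/onW_bij/join_branches_bij.
rewrite (eq_bigr (fun t : {ffun 'I_nb -> {ffun 'I_K -> bool}} =>
  \prod_b ((\prod_j link_weight p (t b j)) * y ^+ branch_received (t b)))); last first.
  move=> t _; rewrite card_received_join expr_sum big_split /=; congr (_ * _).
  rewrite (reindex sensor_index) /=; last first.
    by exists sensor_coords => i _; [exact: sensor_indexK|exact: sensor_coordsK].
  rewrite pair_bigA /=; apply: eq_bigr => -[b j] _.
  by rewrite ffunE sensor_indexK.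
rewrite -(bigA_distr_bigA (fun (_ : 'I_nb) (h : {ffun 'I_K -> bool}) =>
  (\prod_j link_weight p (h j)) * y ^+ branch_received h)) /=.
by rewrite prodr_const card_ord branch_generating_function.
Qed.

End Branches.

End Network.

(** * From the bound on the number of branches to the failure probability *)

Section Numeric.
Context {R : realType}.

(** [exp (2/3) >= 5/3], and [(5/3)^7] exceeds [35]. In the form [ln 32 <= 14/3], this matches the
    constant of the net with the middle term of the bound. *)
Lemma expR_14_3_ge32 : 32 <= expR (14 / 3) :> R.
Proof.
have -> : 14 / 3 = 7%:R * (2 / 3) :> R by field.
rewrite expRM_natl; apply: (@le_trans _ _ ((5 / 3) ^+ 7)).
  by rewrite !exprS expr0; lra.
rewrite lerXn2r ?nnegrE ?expR_ge0//.
by have := expR_ge1Dx (2 / 3 : R); lra.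
Qed.

(** In logarithms the claim follows from [s ln (e N / s) + 14/3 s + ln (2 / eps) <= nb ln (den /
    num)]; both logarithms on the left are nonnegative, so the coefficients [4/3] only add room. *)
Lemma branch_bound_sufficient (C delta p eps : R) (nb K N s : nat) :
  0 < C -> 0 < delta -> 0 < p <= 1 -> 0 < eps < 1 -> (0 < K)%N -> (0 < s <= N)%N ->
  branch_bound C delta p eps K N s <= nb%:R ->
  let y := expR (- (C * delta ^+ 2)) in
  2 * ((expR 1 * N%:R / s%:R) ^+ s * 32 ^+ s) *
    ((1 - p + p * (1 - y) * (p * y) ^+ K) / (1 - p * y)) ^+ nb <= eps.
Proof.
move=> C0 d0 /andP[p0 p1] /andP[e0 e1] K0 /andP[s0 sN]; rewrite /branch_bound /=.
set y := expR (- (C * delta ^+ 2)) => hb.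
have y0 : 0 < y by exact: expR_gt0.
have y1 : y < 1 by rewrite expR_lt1 oppr_lt0 mulr_gt0 ?exprn_gt0.
have q0 : 0 < p * y by rewrite mulr_gt0.
have q1 : p * y < 1.
  by apply: le_lt_trans y1; rewrite ler_piMl// ltW.
have qK0 : 0 < (p * y) ^+ K by rewrite exprn_gt0.
have qK1 : (p * y) ^+ K < 1 by rewrite exprn_ilt1 ?(ltW q0)// -lt0n.
have py1 : 0 < p * (1 - y) by rewrite mulr_gt0// subr_gt0.
have num0 : 0 < 1 - p + p * (1 - y) * (p * y) ^+ K.
  by rewrite ltr_wpDl ?subr_ge0// mulr_gt0.
have num1 : 1 - p + p * (1 - y) * (p * y) ^+ K < 1 - p * y.
  have : p * (1 - y) * (p * y) ^+ K < p * (1 - y) * 1 by rewrite ltr_pM2l.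
  by lra.
set num := 1 - p + _ in hb num0 num1 *.
have den0 : 0 < 1 - p * y by rewrite subr_gt0.
set den := 1 - p * y in hb den0 num1 *.
have D0 : 0 < ln (den / num) by rewrite ln_gt0// ltr_pdivlMr// mul1r.
have GE : num / den = expR (- ln (den / num)).
  by rewrite expRN lnK ?posrE ?divr_gt0// invf_div.
rewrite ler_pdivrMl// in hb.
have sR : 0 < s%:R :> R by rewrite ltr0n.
have NR : 0 < N%:R :> R by rewrite ltr0n (leq_trans s0).
have r0 : 0 < expR 1 * N%:R / s%:R :> R by rewrite divr_gt0// mulr_gt0// expR_gt0.
have l0 : 0 <= ln (expR 1 * N%:R / s%:R) :> R.
  rewrite ln_ge0// ler_pdivlMr// mul1r -[leLHS]mul1r ler_pM ?ler_nat//.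
  by have := expR_ge1Dx (1 : R); lra.
have le0 : 0 <= ln (2 / eps) by rewrite ln_ge0// ler_pdivlMr//; lra.
rewrite GE -expRM_natl -exprMn.
have -> : expR 1 * N%:R / s%:R = expR (ln (expR 1 * N%:R / s%:R)) :> R by rewrite lnK ?posrE.
set l := ln (expR 1 * N%:R / s%:R) in hb l0 *.
have -> : eps = 2 * expR (- ln (2 / eps)).
  by rewrite expRN lnK ?posrE ?divr_gt0// invf_div mulrC divfK.
rewrite -mulrA ler_pM2l//.
apply: (@le_trans _ _ (expR (s%:R * (l + 14 / 3)) * expR (nb%:R * - ln (den / num)))).
  rewrite ler_wpM2r ?expR_ge0// expRM_natl lerXn2r ?nnegrE ?mulr_ge0 ?expR_ge0//.
  by rewrite expRD ler_wpM2l ?expR_ge0// expR_14_3_ge32.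
rewrite -expRD ler_expR.
have sl : 0 <= s%:R * l by rewrite mulr_ge0// ltW.
lra.
Qed.

End Numeric.

(** * Union over the net and averaging over the link patterns *)

Section Recovery.
Context {R : realType} {d : measure_display} {Omega : measurableType d}.
Variable P : probability Omega R.
Local Open Scope ereal_scope.
Context {nb K N : nat}.
Local Notation m := (nb * K)%N.
Variables (A : 'I_m -> 'I_N -> {RV P >-> R}) (L : 'I_m -> {RV P >-> R}).
Local Notation X := (entries_links A L).
Local Notation links := {ffun 'I_m -> bool}.

(** These events cut [Omega] into finitely many pieces on which the received set is constant, so
    conditioning on it becomes a finite sum. *)
Definition link_event (f : links) : set Omega :=
  [set w | forall i, (L i w == 1%R) = f i].

Definition link_target (f : links) (k : ('I_m * 'I_N) + 'I_m) : set R :=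
  match k with inl _ => setT | inr i => if f i then [set 1%R] else ~` [set 1%R] end.

Lemma link_target_measurable f k : measurable (link_target f k).
Proof.
case: k => //= i; case: (f i); first exact: measurable_set1.
by apply: measurableC; exact: measurable_set1.
Qed.

Lemma link_targetP f i w : (X (inr i) @^-1` link_target f (inr i)) w <-> (L i w == 1%R) = f i.
Proof.
rewrite /=; case: (f i) => /=.
  by split => [->|/eqP]; rewrite ?eqxx.
by split => [/eqP/negPf|/negbT/eqP].
Qed.

(** [J = all_links] places the event in the sigma-algebra of the links; [J] full gives its
    probability as a product over the whole index type. *)
Lemma link_eventE f (J : {set ('I_m * 'I_N) + 'I_m}) : (all_links \subset J)%B ->
  link_event f = \bigcap_(k in [set k | k \in J]) (X k @^-1` link_target f k).
Proof.
move=> JL; apply/seteqP; split => w.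
  by move=> H [ij|i] _ //; apply/link_targetP.
move=> H i; apply/link_targetP; apply: H => /=.
by apply: (fintype.subsetP JL); rewrite inE.
Qed.

Lemma link_event_cylinder f : cylinders X all_links (link_event f).
Proof.
by exists (link_target f); [exact: link_target_measurable|exact: link_eventE].
Qed.

Lemma link_event_measurable f : measurable (link_event f).
Proof. exact: cylinder_measurable (link_event_cylinder f). Qed.

Lemma received_set_links f w : link_event f w ->
  received_set (fun i => L i) w = received_links f.
Proof.
move=> H; apply/setP => i; rewrite !inE; apply: eq_forallb => i'.
by rewrite H.
Qed.

Lemma link_event_cover w : exists f, link_event f w.
Proof. by exists [ffun i => L i w == 1%R] => i; rewrite ffunE. Qed.

Hypothesis ind : mutually_independent X.

Lemma link_event_probability (p : R) f : (forall i, P [set w | L i w = 1%R] = p%:E) ->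
  P (link_event f) = (\prod_i link_weight p (f i))%:E.
Proof.
move=> hL; rewrite (@link_eventE f [set: _]%SET (finset.subsetT _)) ind; last exact: link_target_measurable.
rewrite [LHS](eq_bigl xpredT); last by move=> k; rewrite inE.
rewrite big_sumType /= big1 ?mul1e; last first.
  by move=> ij _; rewrite preimage_setT probability_setT.
rewrite -prodEFin; apply: eq_bigr => i _; rewrite /link_weight.
have mL : measurable [set w | L i w = 1%R].
  by rewrite (_ : [set w | _] = L i @^-1` [set 1%R])// -[X in measurable X]setTI; exact: measurable_funPT.
case: (f i); first exact: hL.
rewrite -preimage_setC probability_setC// (_ : L i @^-1` [set 1%R] = [set w | L i w = 1%R])//.
by rewrite hL.
Qed.

Definition bad_sample (s : nat) (delta : R) (T : {set 'I_m}) : set Omega :=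
  \bigcup_(g in [set g : @grid N 4 s | @in_net R N 4 s g])
    [set w | delta / 4 < `|defect (sample A T w) (gridvec g)|]%R.

Lemma bad_sample_block s delta T :
  measurable (bad_sample s delta T : set (block X all_entries)).
Proof.
apply: fin_bigcup_measurable => [|g _]; first exact: finite_finset.
apply: (@measurable_norm_gt _ _ (block X all_entries)).
exact: (@defect_sample_block _ _ _ _ _ _ A L T (gridvec g)).
Qed.

(** The number of rows of the sample varies with [w]. On each [link_event] it is fixed, and there
    [ric_ltP] describes the event by a countable union of finite intersections. *)
Lemma ric_measurable s (delta : R) : (0 < N)%N -> (0 < s)%N ->
  measurable [set w | ric (sample A (received_set (fun i => L i) w) w) s < delta]%R.
Proof.
move=> N0 s0.
rewrite [X in measurable X](_ : _ = \bigcup_(f in [set: links]) (link_event f `&`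
    \bigcup_n \bigcap_(g in [set g : @grid N n.+3 s | @in_net R N n.+3 s g])
      [set w | `|defect (sample A (received_links f) w) (gridvec g)| <=
               delta - (2 * `|delta| + 1) / n.+3%:R]%R)); last first.
  apply/seteqP; split => w /=.
    have [f Hf] := link_event_cover w; rewrite (received_set_links Hf) => /ric_ltP.
    by move=> /(_ N0 s0)[n Hn]; exists f => //; split => //; exists n.
  move=> [f _ [Hf [n _ Hn]]]; rewrite (received_set_links Hf).
  by apply/ric_ltP => //; exists n.
apply: fin_bigcup_measurable => [|f _]; first exact: finite_finset.
apply: measurableI; first exact: link_event_measurable.
apply: bigcup_measurable => n _; apply: fin_bigcap_measurable => [|g _]; first exact: finite_finset.
apply: measurable_norm_le; apply: (@block_fun_measurable _ _ _ P _ X all_entries).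
exact: (@defect_sample_block _ _ _ _ _ _ A L (received_links f) (gridvec g)).
Qed.

Lemma ric_lt_of_not_bad s (delta : R) T w : (0 < N)%N -> (0 < s)%N -> (0 < delta)%R ->
  ~ bad_sample s delta T w -> (ric (sample A T w) s < delta)%R.
Proof.
move=> N0 s0 d0 nb0; apply: (ric_lt_of_bound (c := (delta / 2)%R)) => //; first by lra.
move=> z z1 zs.
have H (g : @grid N 4 s) : @in_net R N 4 s g ->
    (`|defect (sample A T w) (gridvec g)| <= delta / 4)%R.
  by move=> gn; rewrite leNgt; apply/negP => h; apply: nb0; exists g.
have := net_bound (isT : (2 < 4)%N) s0 H zs; rewrite z1 mulr1.
by rewrite (_ : (delta / 4 / (1 - 2 / 4) = delta / 2)%R)//; field.
Qed.

Variable c : R.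
Hypothesis c0 : (0 < c)%R.
Hypothesis hA : forall i j, 'E_P[A i j] = 0 /\ 'V_P[A i j] = 1 /\ subGaussian (A i j) c.

Lemma bad_sample_probability s (delta : R) (T : {set 'I_m}) : (0 < s <= N)%N -> (0 < delta < 1)%R ->
  P (bad_sample s delta T) <=
  (2 * ((expR 1 * N%:R / s%:R) ^+ s * 32 ^+ s) *
     expR (- ((64 * sq_var c)^-1 * delta ^+ 2)) ^+ #|T|)%:E.
Proof.
move=> sN /andP[d0 d1]; have M0 := sq_var_gt0 c0.
pose E (g : @grid N 4 s) := [set w | delta / 4 < `|defect (sample A T w) (gridvec g)|]%R.
have mB : measurable (bad_sample s delta T).
  exact: block_measurable (bad_sample_block s delta T).
have mE g : measurable (E g).
  apply: measurable_norm_gt; apply: (@block_fun_measurable _ _ _ P _ X all_entries).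
  exact: (@defect_sample_block _ _ _ _ _ _ A L T (gridvec g)).
apply: le_trans (@probability_finite_union _ _ _ P _ (@in_net R N 4 s) _ E mB mE _) _.
  by move=> w [g gn Eg]; exists g.
set b : R := (expR (- ((64 * sq_var c)^-1 * delta ^+ 2)) ^+ #|T|)%R.
apply: (@le_trans _ _ (\sum_(g : @grid N 4 s | @in_net R N 4 s g) (2 * b)%:E)).
  apply: lee_sum => g gn; have /and4P[_ _ _ g1] := gn.
  apply: le_trans (defect_sample_tail ind c0 hA T g1 _) _.
    by apply/andP; split; lra.
  rewrite lee_fin ler_pM2l// /b -expRM_natl ler_expR le_eqVlt; apply/orP; left; apply/eqP.
  by field; rewrite gt_eqF.
rewrite sumEFin lee_fin sumr_const -[leLHS]mulr_natr [leLHS]mulrAC ler_wpM2r//.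
  by rewrite exprn_ge0// expR_ge0.
rewrite ler_pM2l//; exact: card_net.
Qed.

Lemma recovery_probability (p eps delta : R) s :
  (0 < K)%N -> (0 < s <= N)%N -> (0 < p <= 1)%R -> (0 < eps < 1)%R -> (0 < delta < 1)%R ->
  (forall i, P [set w | L i w = 1%R] = p%:E) ->
  (branch_bound (64 * sq_var c)^-1 delta p eps K N s <= nb%:R)%R ->
  (1 - eps)%:E <= P [set w | ric (sample A (received_set (fun i => L i) w) w) s < delta]%R.
Proof.
move=> K0 sN p01 e01 d01 hL hb; have [s0 sN'] := andP sN; have [d0 d1] := andP d01.
have [p0 p1] := andP p01.
have N0 : (0 < N)%N by exact: leq_trans sN'.
have M0 := sq_var_gt0 c0; set C : R := ((64 * sq_var c)^-1)%R in hb.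
have C0 : (0 < C)%R by rewrite invr_gt0 mulr_gt0.
set G := [set w | _]; have mG : measurable G by exact: ric_measurable.
have num := branch_bound_sufficient C0 d0 p01 e01 K0 sN hb; rewrite /= in num.
set y := expR (- (C * delta ^+ 2)) in num.
have y1 : (y < 1)%R by rewrite expR_lt1 oppr_lt0 mulr_gt0 ?exprn_gt0.
have py : (p * y != 1)%R.
  by rewrite lt_eqF// (le_lt_trans _ y1)// ler_piMl// expR_ge0.
set net : R := (2 * _)%R in num.
have bad : P (~` G) <= eps%:E.
  have mE (f : links) : measurable (link_event f `&` bad_sample s delta (received_links f)).
    apply: measurableI; first exact: link_event_measurable.
    exact: block_measurable (bad_sample_block _ _ _).
  apply: le_trans (@probability_finite_union _ _ _ P _ xpredT _ _ (measurableC mG) mE _) _.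
    move=> w nG; have [f Hf] := link_event_cover w; exists f => //; split => //.
    apply: contrapT => nbad; apply: nG; rewrite /G /= (received_set_links Hf).
    exact: ric_lt_of_not_bad.
  apply: (@le_trans _ _ (\sum_(f : links) ((\prod_i link_weight p (f i)) *
      (net * y ^+ #|received_links f|))%:E)).
    apply: lee_sum => f _.
    (* With the pattern [f] fixed, the bad event involves only entries and the pattern only links,
       so the probability splits. *)
    rewrite (@block_indep _ _ _ P _ X ind all_links all_entries).
    - rewrite (link_event_probability f hL) EFinM lee_pmul//.
        by rewrite -(link_event_probability f hL).
      exact: bad_sample_probability.
    - by apply/pred0P => -[k|k]; rewrite /= !inE.
    - by apply: sub_sigma_algebra; exact: link_event_cylinder.
    - exact: bad_sample_block.
  rewrite sumEFin lee_fin (le_trans _ num)//.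
  under eq_bigr do rewrite mulrCA.
  by rewrite -mulr_sumr network_generating_function.
have : P (~` G) = 1 - P G by rewrite probability_setC.
have PG : P G \is a fin_num by exact: fin_num_measure.
move=> E; move: bad; rewrite E -(fineK PG) -EFinB !lee_fin; lra.
Qed.

End Recovery.

Theorem theorem3 (R : realType) (c : R) (hc : 0 < c) :
  exists C : R, 0 < C /\
  forall (nb K N s : nat) (p eps delta : R)
    (d : measure_display) (Omega : measurableType d) (P : probability Omega R)
    (A : 'I_(nb * K) -> 'I_N -> {RV P >-> R})
    (L : 'I_(nb * K) -> {RV P >-> R}),
    (0 < nb)%N -> (0 < K)%N -> (0 < N)%N -> (0 < s)%N -> (s <= N)%N ->
    0 <= p <= 1 -> 0 < eps -> 0 < delta < 1 ->
    (* all entries of A and all link variables are mutually independent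
       (entries of A independent, links independent, links independent of A) *)
    mutually_independent
      (fun k : ('I_(nb * K) * 'I_N) + 'I_(nb * K) =>
         match k with inl ij => A ij.1 ij.2 | inr i => L i end) ->
    (* subGaussian random matrix with parameter c *)
    (forall i j, ('E_P[A i j] = 0)%E /\ ('V_P[A i j] = 1)%E /\ subGaussian (A i j) c) ->
    (* Bernoulli erasure channels with success probability p *)
    (forall i w, L i w = 0 \/ L i w = 1) ->
    (forall i, P [set w | L i w = 1] = p%:E) ->
    (* R >= bound, where the bound is +oo when p = 0 *)
    0 < p -> branch_bound C delta p eps K N s <= nb%:R ->
    ((1 - eps)%:E <=
       P [set w | ric (normalized_sub (received_set (fun i => L i) w)
                     (\matrix_(i, j) A i j w)) s < delta]%R)%E.
Proof.
(* [64 = 4 * 4^2]: the Chernoff exponent [eta^2 / (4 * sq_var c)] at the grid threshold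
   [eta = delta / 4]. *)
exists (64 * sq_var c)^-1; split; first by rewrite invr_gt0 mulr_gt0// sq_var_gt0.
move=> nb K N s p eps delta d Omega P A L _ K0 N0 s0 sN /andP[_ p1] e0 d01 ind hA _ hL p0 hb.
(* For [eps >= 1] the claimed lower bound is at most zero. *)
have [e1|e1] := leP 1 eps.
  by apply: (@le_trans _ _ 0%E); [rewrite lee_fin subr_le0|exact: measure_ge0].
apply: (recovery_probability (A := A) (L := L) ind hc hA (p := p)) => //; exact/andP.
Qed.
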